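(* Let $(\mathcal{A},m)=(\mathcal{A}(B_n),m)$ be the Coxeter multiarrangement of type $B_n$. If there exists $X\in L(\mathcal{A})$ with $\mathrm{rank}(X)=2$ and $(\mathcal{A}_X,m_X)=(\mathcal{A}(B_2),m_k)$ for some $k\geq 4$, where $(\mathcal{A}(B_2),m_k)$ is the multiarrangement with defining polynomial $x^2y^k(x-y)^1(x+y)^k$, then no free extension of $(\mathcal{A},m)$ exists.
   Context: Let $\mathbb{K}$ be a field. An arrangement in a finite-dimensional vector space $V$ over $\mathbb{K}$ is a finite set of hyperplanes; all arrangements here are central, i.e. every hyperplane is a linear subspace $H=\ker(\alpha_H)$. An $\ell$-arrangement is one with $\dim V=\ell$. Let $S=S(V^* )$. A multiarrangement $(\mathcal{A},m)$ is an arrangement with a function $m:\mathcal{A}\to\mathbb{Z}_{\geq 0}$; its defining polynomial is $Q(\mathcal{A},m)=\prod_{H}\alpha_H^{m(H)}$. A simple arrangement is one with $m\equiv 1$. The Coxeter arrangement $\mathcal{A}(B_n)$ has defining polynomial $\prod_{i}x_i\prod_{i<j}(x_i-x_j)(x_i+x_j)$; in particular $\mathcal{A}(B_2)$ has defining polynomial $xy(x-y)(x+y)$. $L(\mathcal{A})$ is the set of all intersections of subsets of $\mathcal{A}$, $\mathrm{rank}(X)=\mathrm{codim}(X)$, $\mathcal{A}_X=\{H\in\mathcal{A}\mid X\subseteq H\}$ and $m_X=m|_{\mathcal{A}_X}$. The equality $(\mathcal{A}_X,m_X)=(\mathcal{A}(B_2),m_k)$ is meant up to a linear change of coordinates, i.e.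 there are linearly independent linear forms $u,v$ such that, up to a nonzero scalar, $Q(\mathcal{A}_X,m_X)=u^2v^k(u-v)^1(u+v)^k$. $D(\mathcal{A},m)=\{\theta\in\mathrm{Der}_{\mathbb{K}}(S)\mid \theta(\alpha_H)\in\alpha_H^{m(H)}S \text{ for all } H\in\mathcal{A}\}$, and $(\mathcal{A},m)$ is free if $D(\mathcal{A},m)$ is a free $S$-module. Ziegler restriction: for a simple arrangement $\mathcal{E}$ and $H\in\mathcal{E}$, $\mathcal{E}^H=\{H\cap H'\mid H'\in\mathcal{E}\setminus\{H\}\}$, an arrangement in $H$, with multiplicity $m^H(Y)=|\mathcal{E}_Y|-1$. A simple $(\ell+1)$-arrangement $\mathcal{E}$ is an extension of the $\ell$-multiarrangement $(\mathcal{A},m)$ if there is $H\in\mathcal{E}$ with $(\mathcal{E}^H,m^H)=(\mathcal{A},m)$ (with $H$ identified linearly with the ambient space of $\mathcal{A}$). It is a free extension if $\mathcal{E}$ is moreover free.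
   Formalization: The field K is assumed to have characteristic 0; over fields of characteristic p ≥ 5 the claim fails (for n = 2, k = p there is a supersolvable, hence free, extension by F_p-rational planes), and in characteristic 2 the arrangement B_2 degenerates. *)

(* Defs.v *)
From HB Require Import structures.
From mathcomp Require Import all_boot all_order all_algebra.
From mathcomp Require Import finmap mpoly.
Set Implicit Arguments. Unset Strict Implicit. Unset Printing Implicit Defensive.
Import GRing.Theory.
Local Open Scope ring_scope.

(* The ambient space of an l-arrangement is V = 'rV[K]_l, and S = S(V^* ) is
   {mpoly K[l]}, the variable 'X_i being the i-th coordinate form on V. *)
Notation linform K l := 'Hom('rV[K]_l, K^o).
Notation subspace K l := {vspace 'rV[K]_l}.
Notation arrangement K l := {fset subspace K l}.

Section Arrangements.
Variables (K : fieldType) (l : nat).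
Implicit Types (A : arrangement K l) (X H : subspace K l).

Local Notation S := {mpoly K[l]}.

Definition rank X : nat := (l - \dim X)%N.

Definition is_hyperplane H : bool := (\dim H).+1 == l.

Definition is_arrangement A : Prop := forall H, H \in A -> is_hyperplane H.

Definition coord_form (i : 'I_l) : linform K l :=
  linfun ((fun v : 'rV[K]_l => v 0 i) : 'rV[K]_l -> K^o).

Definition poly_of_form (a : linform K l) : S :=
  \sum_(i < l) (a (delta_mx 0 i) : K) *: 'X_i.

Lemma hyperplane_form H :
  exists a : linform K l, is_hyperplane H ==> (lker a == H).
Proof.
case hH: (is_hyperplane H) => /=; last by exists 0.
have dH : \dim (H^C)%VS = 1%N.
  by rewrite dimv_compl dimvf /dim /= mul1n; move: hH; rewrite /is_hyperplane;
     move: (\dim H) => d /eqP <-; rewrite subSnn.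
have cap0 : (H^C :&: H)%VS = 0%VS by rewrite capvC capv_compl.
set w := vpick (H^C)%VS.
have w0 : w != 0 by rewrite vpick0 -dimv_eq0 dH.
have wE : (H^C)%VS = <[w]>%VS.
  by apply/esym/eqP; rewrite eqEdim -memvE memv_pick /= dim_vline w0 dH.
pose p := daddv_pi (H^C)%VS H.
pose a : linform K l := linfun (fun x : 'rV[K]_l => coord [tuple w] ord0 (p x) : K^o).
have aE x : a x = coord [tuple w] ord0 (p x).
  have lin : linear (fun x : 'rV[K]_l => coord [tuple w] ord0 (p x) : K^o).
    by move=> c y z; rewrite !linearP.
  pose f := GRing.isLinear.Build _ _ _ _ _ lin.
  pose g : {linear 'rV[K]_l -> K^o} := HB.pack (fun x : 'rV[K]_l => coord [tuple w] ord0 (p x) : K^o) f.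
  exact: (lfunE g).
have pC x : p x \in <[w]>%VS by rewrite -wE memv_pi.
have fw : free [tuple w] by rewrite seq1_free.
exists a; apply/eqP/vspaceP => x; rewrite memv_ker aE.
have pE : (coord [tuple w] ord0 (p x) == 0) = (p x == 0).
  have := pC x => /vlineP[c ->].
  have cw : coord [tuple w] ord0 w = 1.
    by rewrite -[X in coord _ _ X]/([tuple w]`_(ord0 : 'I_1)) coord_free.
  rewrite linearZ /= cw; apply: etrans (congr1 (fun z => z == 0) (mulr1 c)) _.
  by rewrite scaler_eq0 (negPf w0) orbF.
rewrite pE.
have xE : p x + daddv_pi H (H^C)%VS x = x.
  by apply: daddv_pi_add => //; rewrite addvC addv_complf memvf.
apply/eqP/idP => [p0|xH].
  by rewrite -xE p0 add0r memv_pi.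
have q := daddv_pi_id (capv_compl H) xH.
by apply: (@addIr _ x); rewrite add0r -[RHS]xE q.
Qed.

(* alpha_H; only meaningful when H is a hyperplane, and then determined by H up
   to a nonzero scalar. *)
Definition alpha H : linform K l := xchoose (hyperplane_form H).

Lemma lker_alpha H : is_hyperplane H -> lker (alpha H) = H.
Proof. by move=> hH; apply/eqP; apply: (implyP (xchooseP (hyperplane_form H))). Qed.

(* A multiplicity is given by a total function, of which only the values on the
   arrangement are used. *)
Definition defining_poly A (m : subspace K l -> nat) : S :=
  \prod_(H <- A) poly_of_form (alpha H) ^+ m H.

Definition in_lattice A X : Prop :=
  exists2 B : arrangement K l, (B `<=` A)%fset & X = (\bigcap_(H <- B) H)%VS.

Definition localization A X : arrangement K l :=
  [fset H in A | (X <= H)%VS]%fset.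

Definition is_derivation (theta : S -> S) : Prop :=
  linear theta /\ forall f g, theta (f * g) = f * theta g + g * theta f.

Definition in_D A (m : subspace K l -> nat) (theta : S -> S) : Prop :=
  is_derivation theta /\
  forall H, H \in A -> exists g : S,
    theta (poly_of_form (alpha H)) = poly_of_form (alpha H) ^+ m H * g.

(* D(A, m) is a submodule of the Noetherian S-module Der(S), so that any basis
   of it is finite. *)
Definition is_free A (m : subspace K l -> nat) : Prop :=
  exists (r : nat) (b : 'I_r -> S -> S),
    (forall i, in_D A m (b i)) /\
    forall theta, in_D A m theta ->
      exists! c : {ffun 'I_r -> S},
        forall f, theta f = \sum_(i < r) c i * b i f.

Definition ziegler_arr A H : arrangement K l :=
  [fset (H :&: H')%VS | H' in (A `\ H)%fset]%fset.

Definition ziegler_mult A (Y : subspace K l) : nat :=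
  #|` localization A Y|.-1.

End Arrangements.

Definition coxeterB (K : fieldType) (n : nat) : arrangement K n :=
  ([fset lker (coord_form K i) | i : 'I_n]
  `|` [fset lker (coord_form K p.1 - coord_form K p.2)%R
      | p : 'I_n * 'I_n & (p.1 < p.2)%N]
  `|` [fset lker (coord_form K p.1 + coord_form K p.2)%R
      | p : 'I_n * 'I_n & (p.1 < p.2)%N])%fset.

(* phi identifies K^l with H; ziegler_arr consists of subspaces of H, viewed in
   the ambient space of E. *)
Definition is_extension (K : fieldType) (l : nat) (E : arrangement K l.+1)
    (A : arrangement K l) (m : subspace K l -> nat) : Prop :=
  is_arrangement E /\
  exists2 H : subspace K l.+1, H \in E &
  exists phi : 'Hom('rV[K]_l, 'rV[K]_l.+1),
    [/\ lker phi = 0%VS, limg phi = H,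
        ziegler_arr E H = [fset (phi @: Y)%VS | Y in A]%fset &
        forall Y, Y \in A -> ziegler_mult E (phi @: Y)%VS = m Y].

Definition is_free_extension (K : fieldType) (l : nat) (E : arrangement K l.+1)
    (A : arrangement K l) (m : subspace K l -> nat) : Prop :=
  is_extension E A m /\ is_free E (fun=> 1%N).

(* (A, m) is x^2 y^k (x - y) (x + y)^k up to a linear change of coordinates. *)
Definition is_B2_mk (K : fieldType) (l : nat) (A : arrangement K l)
    (m : subspace K l -> nat) (k : nat) : Prop :=
  exists (u v : linform K l) (c : K),
    [/\ free [:: u; v], c != 0 &
        defining_poly A m =
          c *: (poly_of_form u ^+ 2 * poly_of_form v ^+ k *
                poly_of_form (u - v) * poly_of_form (u + v) ^+ k)].

(* Main.v *)
(* Localizing at a generic point [p] of [phi X] and using Saito's criterion, a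
   free extension yields a basis [theta_i] of [D(E)] with [det = c Q(E)].  In
   coordinates [x, y, z] with [H = ker z], the hyperplanes through [p] are [z],
   two [x - a z], [k] forms [y - b z], [x - y] and [k] forms [x + y - c z].
   Comparing the lowest-order terms of the determinant at [p] gives, after
   subtracting multiples of the Euler field and setting [z = 1], two planar
   fields [(f, g)] tangent to these [2 k + 3] affine lines, of degrees adding up
   to at most [2 k + 3] and linearly independent.  Write [g = B(y) G] and
   [f + g = C(x + y) P], where [B] and [C] have the [b]'s and [c]'s as roots.
   For the field of smaller degree [G] and [P] are affine linear, and the two
   fields together force [P G' - P' G] to be a multiple of
   [(x - a1) (x - a2) (x - y)].  Restricting to these three lines gives
   [B(y) G(a, y) = C(a + y) P(a, y)] and [C(2 x) P(x, x) = 2 B(x) G(x, x)], hence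
   relations between the first three power sums of the [b]'s and the [c]'s.
   Centered at the common zero of [G] and [P], which lies on one of the three
   lines, they leave one equation in [k], which fails for [k >= 4]. *)
Require Import Defs.
From mathcomp Require Import all_boot all_order all_algebra.
From mathcomp Require Import fingroup perm finmap mpoly.
From mathcomp Require Import ring zify.
Import GRing.Theory.
Local Open Scope ring_scope.

Set Implicit Arguments. Unset Strict Implicit. Unset Printing Implicit Defensive.

(** * Divisibility and primality of linear forms *)

Section Divisibility.
Variable R : comNzRingType.
Implicit Types a b c p f g : R.

(** Two orders of vanishing at the generic point are in conflict. Q(E) vanishes there to order at
    most 2k+4; if all minors of planar fields of total degree at most 2k+3 were zero, the
    determinant would be divisible by t^(2k+5): one t from each of three components and 2k+2 from
    the minors. The basis need not be homogeneous, so coefficients of powers of t replace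
    homogeneous components. Since 2k+3 is odd, the smaller degree is at most k+1, which makes G and
    P affine; the degree left for P G' - P' G is 3, exactly the number of lines that must divide it.
    With the coefficient of y in G and P scaled to 1, that of x is p - 1 in P and p + k - 1 in G,
    where p (2^(k-1) - 1) = k. The power of two comes from the diagonal, on which x + y - c becomes
    2x - c; hence the recurring q = 2^(k-1) - 1. Both final equations do hold for k = 3, p = 1, so
    this is where k >= 4 takes its force. Characteristic zero keeps the integers in these relations
    nonzero, supplies generic points, and identifies the size of a basis with l. *)

Definition dvdr a b := exists q, b = a * q.

Lemma dvdr_refl a : dvdr a a.
Proof. by exists 1; rewrite mulr1. Qed.

Lemma dvdr0 a : dvdr a 0.
Proof. by exists 0; rewrite mulr0. Qed.

Lemma dvdrMl a b c : dvdr a b -> dvdr a (b * c).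
Proof. by case=> q ->; exists (q * c); rewrite mulrA. Qed.

Lemma dvdrMr a b c : dvdr a c -> dvdr a (b * c).
Proof. by rewrite mulrC; apply: dvdrMl. Qed.

Lemma dvdrM a b c d : dvdr a b -> dvdr c d -> dvdr (a * c) (b * d).
Proof. by case=> q -> [r ->]; exists (q * r); rewrite mulrACA. Qed.

Lemma dvdrD a b c : dvdr a b -> dvdr a c -> dvdr a (b + c).
Proof. by case=> q -> [r ->]; exists (q + r); rewrite mulrDr. Qed.

Lemma dvdrN a b : dvdr a b -> dvdr a (- b).
Proof. by case=> q ->; exists (- q); rewrite mulrN. Qed.

Lemma dvdrB a b c : dvdr a b -> dvdr a c -> dvdr a (b - c).
Proof. by move=> ab ac; apply: dvdrD => //; apply: dvdrN. Qed.

Lemma dvdr_sum a (I : Type) (s : seq I) (P : pred I) (F : I -> R) :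
  (forall i, P i -> dvdr a (F i)) -> dvdr a (\sum_(i <- s | P i) F i).
Proof.
move=> h; elim/big_ind: _ => //; [exact: dvdr0 | by move=> *; apply: dvdrD].
Qed.

Lemma dvdr_prodS a (I : eqType) (s : seq I) (F : I -> R) i :
  i \in s -> dvdr a (F i) -> dvdr a (\prod_(j <- s) F j).
Proof. by move=> si h; rewrite (big_rem i) //=; apply: dvdrMl. Qed.

Definition prime_elt p :=
  ~ dvdr p 1 /\ forall f g, dvdr p (f * g) -> dvdr p f \/ dvdr p g.

Lemma prime_elt_prod p (I : eqType) (s : seq I) (F : I -> R) :
  prime_elt p -> dvdr p (\prod_(i <- s) F i) -> exists2 i, i \in s & dvdr p (F i).
Proof.
case=> p1 pM; elim: s => [|i s IH]; first by rewrite big_nil => /p1.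
rewrite big_cons => /pM[|/IH[j sj ?]]; first by exists i; rewrite ?inE ?eqxx.
by exists j; rewrite // inE sj orbT.
Qed.

Lemma prime_elt_exp p f n : prime_elt p -> dvdr p (f ^+ n) -> dvdr p f.
Proof.
by case=> p1 pM; elim: n => [/p1//|n IH]; rewrite exprS => /pM[|/IH].
Qed.

End Divisibility.

Section PrimeProducts.
Variable R : idomainType.

(** Once one prime is divided out, each remaining prime must divide the quotient, because it does
    not divide the one removed. *)
Lemma prod_primes_dvdr (I : eqType) (s : seq I) (F : I -> R) f :
  uniq s -> {in s, forall i, prime_elt (F i)} ->
  {in s &, forall i j, i != j -> ~ dvdr (F i) (F j)} ->
  {in s, forall i, dvdr (F i) f} -> dvdr (\prod_(i <- s) F i) f.
Proof.
elim: s f => [|i s IH] f; first by rewrite big_nil => *; exists f; rewrite mul1r.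
case/andP=> si us prF cF dF; rewrite big_cons.
have [q fE] := dF i (mem_head i s); rewrite fE.
apply: dvdrM; first exact: dvdr_refl.
apply: IH => // [j sj|j l sj sl|j sj]; first by apply: prF; rewrite inE sj orbT.
- by apply: cF; rewrite inE ?sj ?sl orbT.
have js : j \in i :: s by rewrite inE sj orbT.
have := dF j js; rewrite fE => /(prF j js).2[] // /cF[] //; first exact: mem_head.
by apply: contraNneq si => <-.
Qed.

(** A prime that does not divide [u] must divide the cofactor of [u], so it can be cancelled. In
    Saito's criterion this reduces the extra factor of the determinant to a divisor of a
    constant. *)
Lemma dvdr_cancel_primes (I : eqType) (s : seq I) (F : I -> R) u c :
  {in s, forall i, F i != 0} -> {in s, forall i, prime_elt (F i)} ->
  {in s, forall i, ~ dvdr (F i) u} ->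
  dvdr u (c * \prod_(i <- s) F i) -> dvdr u c.
Proof.
elim: s => [|i s IH] nzF prF nF; first by rewrite big_nil mulr1.
have is_ := mem_head i s; rewrite big_cons => -[v].
rewrite mulrCA => uv.
have : dvdr (F i) (u * v) by rewrite -uv; apply: dvdrMl; apply: dvdr_refl.
case/(prF i is_).2 => [/(nF i is_)//|[w vE]].
apply: IH => [j sj|j sj|j sj|]; try by [apply: nzF | apply: prF | apply: nF];
  try by (apply: nzF || apply: prF || apply: nF); rewrite inE sj orbT.
by exists w; apply: (mulfI (nzF i is_)); rewrite uv vE mulrCA.
Qed.

Lemma prime_exp_eq (p f g : R) a b :
  p != 0 -> ~ dvdr p f -> ~ dvdr p g -> p ^+ a * f = p ^+ b * g -> a = b.
Proof.
move=> p0; elim: a b => [|a IH] [|b] nf ng //.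
- by rewrite mul1r => fE; case: nf; rewrite fE exprS -mulrA; exists (p ^+ b * g).
- by rewrite mul1r => gE; case: ng; rewrite -gE exprS -mulrA; exists (p ^+ a * f).
by rewrite !exprS -!mulrA => /(mulfI p0) /IH ->.
Qed.

End PrimeProducts.

Section Affine.
Variables (K : fieldType) (n : nat).
Local Notation S := {mpoly K[n]}.

Lemma mpoly_ring_ind (P : S -> Prop) :
  (forall c, P c%:MP) -> (forall i, P 'X_i) ->
  (forall f g, P f -> P g -> P (f + g)) ->
  (forall f g, P f -> P g -> P (f * g)) -> forall f, P f.
Proof.
move=> PC PX PD PM; elim/mpolyind => [|c m f _ _ Pf]; first exact: PC.
apply: PD => //; rewrite -mul_mpolyC; apply: (PM) => //.
rewrite mpolyXE_id; apply: (big_ind P); [exact: (PC 1) | exact: PM |].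
by move=> i _; elim: (m i) => [|d IH]; [exact: PC | rewrite exprS; apply: PM].
Qed.

Definition affine (a0 : K) (a : 'I_n -> K) : S := a0%:MP + \sum_i a i *: 'X_i.

Lemma meval_affine a0 a v : (affine a0 a).@[v] = a0 + \sum_i a i * v i.
Proof.
rewrite /affine mevalD mevalC rmorph_sum /=; congr (_ + _).
by apply: eq_bigr => i _; rewrite mevalZ mevalXU.
Qed.

Lemma mcoeff_affine a0 a i : (affine a0 a)@_U_(i) = a i.
Proof.
rewrite /affine mcoeffD mcoeffC mnm1_eq0 mulr0 add0r raddf_sum /= (bigD1 i) //=.
rewrite mcoeffZ mcoeffX eqxx mulr1 big1 ?addr0 // => j ji.
by rewrite mcoeffZ mcoeffX eq_mnm1 (negPf ji) mulr0.
Qed.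

Lemma affine_neq0 a0 a i : a i != 0 -> affine a0 a != 0.
Proof. by apply: contraNneq => aE; rewrite -(mcoeff_affine a0) aE mcoeff0. Qed.

(* Modulo the form one may substitute for the variable of a nonzero coefficient;
   the substitution kills exactly the multiples of the form, hence the form is
   prime. *)
Lemma affine_prime a0 a i : a i != 0 -> prime_elt (affine a0 a).
Proof.
move=> ai; set L := affine a0 a.
pose h j := 'X_j - ((j == i)%:R * (a i)^-1) *: L : S.
pose s : {rmorphism S -> S} := mmap (@mpolyC n K) h.
have sC c : s c%:MP = c%:MP by rewrite /s /= mmapC.
have sX j : s 'X_j = h j by rewrite /s /= mmapX mmap1U.
have sL : s L = 0.
  rewrite /L /affine rmorphD sC rmorph_sum /=.
  under eq_bigr => j _.
    rewrite -mul_mpolyC rmorphM [X in X * _]sC [X in _ * X]sX mul_mpolyC /h.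
    rewrite scalerBr scalerA mulrCA.
    over.
  rewrite sumrB addrA -/(affine a0 a) -/L (bigD1 i) //= eqxx mul1r mulfV // scale1r.
  by rewrite big1 ?addr0 ?subrr // => j /negPf ->; rewrite mul0r scale0r.
have sE f : dvdr L (f - s f).
  elim/mpoly_ring_ind: f => [c|j|f g hf hg|f g hf hg].
  - by rewrite sC subrr; apply: dvdr0.
  - by rewrite sX /h subKr -mul_mpolyC; apply: dvdrMr; apply: dvdr_refl.
  - by rewrite rmorphD opprD addrACA; apply: dvdrD.
  have -> : f * g - s (f * g) = (f - s f) * g + s f * (g - s g).
    by rewrite rmorphM mulrBl mulrBr addrA subrK.
  by apply: dvdrD; [apply: dvdrMl | apply: dvdrMr].
have sP f : s f = 0 -> dvdr L f by move=> f0; have := sE f; rewrite f0 subr0.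
have sN f : dvdr L f -> s f = 0 by case=> q ->; rewrite rmorphM sL mul0r.
split=> [/sN/eqP|f g /sN/eqP]; first by rewrite rmorph1 oner_eq0.
by rewrite rmorphM mulf_eq0 => /orP[] /eqP /sP; [left | right].
Qed.

Lemma not_dvdr_meval (f g : S) v : f.@[v] = 0 -> g.@[v] != 0 -> ~ dvdr f g.
Proof. by move=> f0 g0 [q gE]; move: g0; rewrite gE mevalM f0 mul0r eqxx. Qed.

End Affine.

(** * Saito's criterion *)

Section Forms.
Variables (K : fieldType) (l : nat).
Local Notation S := {mpoly K[l]}.
Implicit Types (a : linform K l) (H : subspace K l).

Definition form_coef a (i : 'I_l) : K := a (delta_mx 0 i).

Lemma linform_sum a (v : 'rV[K]_l) : a v = \sum_i form_coef a i * v 0 i :> K.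
Proof.
rewrite [in LHS](row_sum_delta v) linear_sum /=; apply: eq_bigr => i _.
by rewrite linearZ mulrC.
Qed.

Lemma poly_of_formE a : poly_of_form a = affine 0 (form_coef a).
Proof. by rewrite /affine mpolyC0 add0r. Qed.

Lemma meval_form a (v : 'rV[K]_l) : (poly_of_form a).@[fun i => v 0 i] = a v.
Proof. by rewrite poly_of_formE meval_affine add0r -linform_sum. Qed.

Lemma form_coef_neq0 a : a != 0 -> exists i, form_coef a i != 0.
Proof.
move=> a0; apply/existsP; apply: contraR a0; rewrite negb_exists => /forallP h.
apply/eqP/lfunP => v; rewrite lfunE /= linform_sum big1 // => i _.
by have := h i; rewrite negbK => /eqP ->; rewrite mul0r.
Qed.

Lemma form_prime a : a != 0 -> prime_elt (poly_of_form a).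
Proof. by case/form_coef_neq0 => i ai; rewrite poly_of_formE; apply: affine_prime ai. Qed.

Lemma poly_of_form_neq0 a : a != 0 -> poly_of_form a != 0.
Proof. by case/form_coef_neq0 => i ai; rewrite poly_of_formE; apply: affine_neq0 ai. Qed.

Lemma dimv_rowspace : \dim (fullv : subspace K l) = l.
Proof. by rewrite dimvf /dim /= mul1n. Qed.

Lemma alpha_neq0 H : is_hyperplane H -> alpha H != 0.
Proof.
move=> hH; apply/eqP => a0; have := lker_alpha hH; rewrite a0.
have -> : lker (0 : linform K l) = fullv.
  by apply/vspaceP => v; rewrite memv_ker lfunE /= eqxx memvf.
by move=> HE; move: hH; rewrite /is_hyperplane -HE dimv_rowspace gtn_eqF.
Qed.

Lemma hyperplane_vanish H v : is_hyperplane H -> (alpha H v == 0) = (v \in H).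
Proof. by move=> hH; rewrite -memv_ker lker_alpha. Qed.

Lemma hyperplane_forms_coprime H H' : is_hyperplane H -> is_hyperplane H' ->
  H != H' -> ~ dvdr (poly_of_form (alpha H)) (poly_of_form (alpha H')).
Proof.
move=> hH hH' neq; have /subvPn[v vH vH'] : ~~ (H <= H')%VS.
  apply: contraNN neq => sub; rewrite eqEdim sub /=.
  have dE : \dim H = \dim H' := succn_inj (etrans (eqP hH) (esym (eqP hH'))).
  by rewrite dE.
apply: (not_dvdr_meval (v := fun i => v 0 i)); rewrite meval_form.
  by apply/eqP; rewrite hyperplane_vanish.
by rewrite hyperplane_vanish.
Qed.

End Forms.

Section Derivations.
Variables (K : fieldType) (l : nat).
Local Notation S := {mpoly K[l]}.

Definition vector_field (v : 'rV[S]_l) (f : S) : S := \sum_j v 0 j * f^`M(j).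

Lemma vector_field_derivation v : is_derivation (vector_field v).
Proof.
split=> [c f g|f g]; rewrite /vector_field.
  rewrite scaler_sumr -big_split /=; apply: eq_bigr => j _.
  by rewrite mderivD mderivZ mulrDr scalerAr.
rewrite !mulr_sumr -big_split /=; apply: eq_bigr => j _.
by rewrite mderivM; ring.
Qed.

Lemma vector_fieldX v j : vector_field v 'X_j = v 0 j.
Proof.
rewrite /vector_field (bigD1 j) //= big1 => [|i ij]; rewrite mderivX mnm1E.
  have -> : (U_(j) - U_(j) = 0)%MM by apply/mnmP => i; rewrite mnmBE subnn mnm0E.
  by rewrite eqxx scale1r mpolyX0 mulr1 addr0.
by rewrite eq_sym (negPf ij) scale0r mulr0.
Qed.

Section Fixed.
Variable theta : S -> S.
Hypothesis der : is_derivation theta.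

Let lin : linear theta := der.1.

Lemma derivationD f g : theta (f + g) = theta f + theta g.
Proof. by have := lin 1 f g; rewrite !scale1r. Qed.

Lemma derivation_0 : theta 0 = 0.
Proof. by apply: (@addrI _ (theta 0)); rewrite -derivationD !addr0. Qed.

Lemma derivationZ c f : theta (c *: f) = c *: theta f.
Proof. by have := lin c f 0; rewrite derivation_0 !addr0. Qed.

Lemma derivation_sum (I : Type) (s : seq I) (F : I -> S) :
  theta (\sum_(i <- s) F i) = \sum_(i <- s) theta (F i).
Proof. by apply: (big_morph theta derivationD derivation_0). Qed.

(** Both sides are derivations that agree on constants and variables, so Der(S) is free on the
    partial derivatives and a derivation may be replaced by its row of coefficients. *)
Lemma derivation_vector_field f : theta f = vector_field (\row_j theta 'X_j) f.
Proof.
have [Dlin DM] := vector_field_derivation (\row_j theta 'X_j).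
elim/mpoly_ring_ind: f => [c|j|f g hf hg|f g hf hg].
- rewrite -[c%:MP]mulr1 mul_mpolyC derivationZ.
  have -> : theta 1 = 0.
    apply: (@addrI _ (theta 1)); rewrite addr0.
    by have := der.2 1 1; rewrite mulr1 mul1r => <-.
  rewrite scaler0 /vector_field big1 // => j _.
  by rewrite mderivZ mderivC scaler0 mulr0.
- by rewrite vector_fieldX mxE.
- by rewrite derivationD hf hg; have := Dlin 1 f g; rewrite !scale1r.
by rewrite (der.2) DM hf hg.
Qed.

Lemma derivation_form a :
  theta (poly_of_form a) = \sum_j theta 'X_j * (form_coef a j)%:MP.
Proof.
rewrite derivation_sum; apply: eq_bigr => j _.
by rewrite derivationZ mulrC mul_mpolyC.
Qed.

End Fixed.
End Derivations.

Section Saito.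
Variables (K : fieldType) (l : nat).
Hypothesis char0 : [pchar K] =i pred0.
Local Notation S := {mpoly K[l]}.
Variable E : arrangement K l.
Hypothesis arrE : is_arrangement E.
Local Notation L H := (poly_of_form (alpha H)).
Local Notation Q := (\prod_(H <- E) L H).

(** Membership in D(E) stated on coefficient rows: the sum is theta(alpha_H). Rows rather than maps
    make matrices and determinants available. *)
Definition log_row (v : 'rV[S]_l) : Prop :=
  forall H, H \in E -> dvdr (L H) (\sum_j v 0 j * (form_coef (alpha H) j)%:MP).

Lemma in_D_log_row theta : in_D E (fun=> 1%N) theta -> log_row (\row_j theta 'X_j).
Proof.
case=> der h H HE; have [g tE] := h H HE; exists g.
by under eq_bigr do rewrite mxE; rewrite -derivation_form // tE expr1.
Qed.

Lemma log_row_in_D v : log_row v -> in_D E (fun=> 1%N) (vector_field v).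
Proof.
move=> lv; split; first exact: vector_field_derivation.
move=> H HE; have [g gE] := lv H HE; exists g; rewrite expr1 -gE.
rewrite (derivation_form (vector_field_derivation v)).
by apply: eq_bigr => j _; rewrite vector_fieldX.
Qed.

Lemma natr_inj_char0 : injective (fun n => n%:R : K).
Proof.
move=> m n /eqP; wlog mn : m n / (m <= n)%N => [h|].
  by case/orP: (leq_total m n) => /h // {}h; rewrite eq_sym => /h.
rewrite eq_sym -subr_eq0 -natrB // => h; apply/eqP; rewrite eqn_leq mn /=.
by rewrite -subn_eq0 -(pcharf0P K).1.
Qed.

Lemma arrangement_prime H : H \in E -> prime_elt (L H).
Proof. by move=> HE; apply/form_prime/alpha_neq0/arrE. Qed.

Lemma arrangement_form_neq0 H : H \in E -> L H != 0.
Proof. by move=> HE; apply/poly_of_form_neq0/alpha_neq0/arrE. Qed.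

Lemma arrangement_poly_neq0 : Q != 0.
Proof.
rewrite prodf_seq_neq0; apply/allP => H HE /=; exact: arrangement_form_neq0.
Qed.

Lemma arrangement_coprime :
  {in E &, forall H H', H != H' -> ~ dvdr (L H) (L H')}.
Proof. by move=> H H' HE HE'; apply: hyperplane_forms_coprime; apply: arrE. Qed.

(** For each H, the product of [M] with the coefficient column of alpha_H is divisible by alpha_H.
    Multiplying by the adjugate gives det M times that column, which has a nonzero constant entry;
    coprimality of the forms then assembles Q. *)
Lemma log_det_dvdr (M : 'M[S]_l) :
  (forall i, log_row (row i M)) -> dvdr Q (\det M).
Proof.
move=> logM; apply: prod_primes_dvdr; first exact: fset_uniq.
- exact: arrangement_prime.
- exact: arrangement_coprime.
move=> H HE; have [j cj] := form_coef_neq0 (alpha_neq0 (arrE HE)).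
pose xi : 'cV[S]_l := \col_j (form_coef (alpha H) j)%:MP.
have : dvdr (L H) ((\adj M *m (M *m xi)) j 0).
  rewrite mxE; apply: dvdr_sum => i _; apply: dvdrMr; rewrite mxE.
  by have := logM i H HE; under eq_bigr do rewrite mxE; under [X in _ -> dvdr _ X]eq_bigr do rewrite mxE.
rewrite mulmxA mul_adj_mx mul_scalar_mx !mxE => h.
have -> : \det M = \det M * (form_coef (alpha H) j)%:MP * ((form_coef (alpha H) j)^-1)%:MP.
  by rewrite -mulrA -mpolyCM mulfV // mulr1.
exact: dvdrMl.
Qed.

(** Explicit logarithmic rows are expressed through [M]: Q e_j0, and R (a_j0 e_i - a_i e_j0) for i
    other than j0, where R is the product of the other forms and a the coefficients of alpha_H. The
    latter rows kill alpha_H. Their determinant Q (a_j0 R)^(l-1) contains alpha_H only once, which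
    bounds the power of alpha_H in det M. *)
Lemma log_det_cofactor (M : 'M[S]_l) H : H \in E ->
  (forall v, log_row v -> exists c : 'rV_l, v = c *m M) ->
  exists (d : S) (c : K), c != 0 /\
    d * \det M = Q * (c%:MP * \prod_(y <- rem H E) L y) ^+ l.-1.
Proof.
move=> HE span; have [j0 c0] := form_coef_neq0 (alpha_neq0 (arrE HE)).
set a := form_coef (alpha H) in c0; set R := \prod_(y <- rem H E) L y.
have QE : Q = L H * R by rewrite (big_rem H).
pose D : 'M[S]_l := \matrix_(i, j) if i == j0 then Q * (j == j0)%:R
  else R * ((a j0)%:MP * (j == i)%:R - (a i)%:MP * (j == j0)%:R).
have dvdR H' : H' \in E -> H' != H -> dvdr (L H') R.
  move=> HE' neq; apply: (dvdr_prodS (i := H')); last exact: dvdr_refl.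
  by rewrite mem_rem_uniq ?fset_uniq // inE neq.
have logD i : log_row (row i D).
  move=> H' HE'; have [ij|ij] := eqVneq i j0.
    apply: dvdr_sum => j _; rewrite !mxE ij eqxx -mulrA; apply: dvdrMl.
    by apply: (dvdr_prodS (i := H')) => //; apply: dvdr_refl.
  have -> : \sum_j row i D 0 j * (form_coef (alpha H') j)%:MP =
     R * ((a j0)%:MP * (form_coef (alpha H') i)%:MP
          - (a i)%:MP * (form_coef (alpha H') j0)%:MP).
    under eq_bigr do rewrite !mxE (negPf ij) -mulrA mulrBl.
    rewrite -mulr_sumr sumrB; congr (_ * (_ - _)).
      rewrite (bigD1 i) //= eqxx mulr1 big1 ?addr0 // => j /negPf ->.
      by rewrite mulr0 mul0r.
    rewrite (bigD1 j0) //= eqxx mulr1 big1 ?addr0 // => j /negPf ->.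
    by rewrite mulr0 mul0r.
  have [->|neq] := eqVneq H' H; last by apply: dvdrMl; apply: dvdR.
  by rewrite -/a [X in X - _]mulrC subrr mulr0; apply: dvdr0.
have /fin_all_exists[c cE] i := span _ (logD i).
exists (\det (\matrix_i c i)), (a j0); split=> //.
rewrite -det_mulmx; have -> : (\matrix_i c i) *m M = D.
  by apply/row_matrixP => i; rewrite row_mul rowK cE.
rewrite (expand_det_row _ j0) (bigD1 j0) //= big1 => [|j jj0]; last first.
  by rewrite mxE eqxx (negPf jj0) mulr0 mul0r.
rewrite addr0 mxE !eqxx mulr1; congr (_ * _); rewrite /cofactor -signr_odd addnn odd_double mul1r.
rewrite -det_scalar; congr (\det _); apply/matrixP => i j; rewrite !mxE.
rewrite eq_sym (negPf (neq_lift _ _)) (inj_eq lift_inj).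
rewrite [lift j0 j == j0]eq_sym (negPf (neq_lift _ _)) mulr0 subr0.
by rewrite mulrCA -[in RHS]mulr_natr mulrA [j == i]eq_sym.
Qed.

Lemma mpoly_dvd_const (u : S) c : c != 0 -> dvdr u c%:MP ->
  exists2 d, d != 0 & u = d%:MP.
Proof.
move=> c0 [v uv]; apply/msize_poly1P.
have uv0 : u * v != 0 by rewrite -uv mpolyC_eq0.
have u0 : u != 0 by apply: contraNneq uv0 => ->; rewrite mul0r.
have v0 : v != 0 by apply: contraNneq uv0 => ->; rewrite mulr0.
have := msizeM u0 v0; rewrite -uv msizeC c0.
by move: u0 v0; rewrite -!msize_poly_eq0; move: (msize u) (msize v) => x y; lia.
Qed.

Theorem saito_criterion H0 : H0 \in E -> is_free E (fun=> 1%N) ->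
  exists (M : 'M[S]_l) (c : K),
    [/\ c != 0, forall i, log_row (row i M) & \det M = c%:MP * Q].
Proof.
move=> HE0 [r [b [bD bB]]].
pose M : 'M[S]_(r, l) := \matrix_(i, j) b i 'X_j.
have span v : log_row v -> exists c : 'rV_r, v = c *m M.
  move=> /log_row_in_D /bB[c [cE _]]; exists (\row_i c i).
  apply/rowP => j; rewrite -vector_fieldX cE mxE.
  by apply: eq_bigr => i _; rewrite !mxE.
have indep (c : 'rV_r) : c *m M = 0 -> c = 0.
  move=> c0; have lz : log_row 0.
    by move=> H HE; rewrite big1 => [|j _]; [apply: dvdr0 | rewrite mxE mul0r].
  have [e [eE eU]] := bB _ (log_row_in_D lz).
  have z f : vector_field (0 : 'rV[S]_l) f = 0.
    by rewrite /vector_field big1 // => j _; rewrite mxE mul0r.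
  have e1 : e = [ffun=> 0].
    by apply: eU => f; rewrite z big1 // => i _; rewrite ffunE mul0r.
  have e2 : e = [ffun i => c 0 i].
    apply: eU => f; rewrite z; under eq_bigr => i _.
      rewrite ffunE (derivation_vector_field (bD i).1) /vector_field mulr_sumr.
      under eq_bigr do rewrite mxE mulrA.
      over.
    rewrite exchange_big /= big1 // => j _; rewrite -mulr_suml.
    have := congr1 (fun A : 'rV_l => A 0 j) c0; rewrite !mxE => h.
    have -> : \sum_i c 0 i * b i 'X_j = 0.
      by rewrite -[RHS]h; apply: eq_bigr => i _; rewrite mxE.
    by rewrite mul0r.
  apply/rowP => i; rewrite mxE; have := congr1 (fun g : {ffun 'I_r -> S} => g i) e2.
  by rewrite e1 !ffunE.
(* Q times a coordinate field is always logarithmic; expressing these fields in the basis inverts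
   [M] up to the factor Q, on both sides by independence. *)
have Qdelta i : log_row (Q *: delta_mx 0 i).
  move=> H HE; apply: dvdr_sum => j _; rewrite mxE -mulrA; apply: dvdrMl.
  by apply: (dvdr_prodS (i := H)) => //; apply: dvdr_refl.
have /fin_all_exists[n nE] i := span _ (Qdelta i).
pose N : 'M[S]_(l, r) := \matrix_i n i.
have NM : N *m M = Q%:M.
  apply/row_matrixP => i; rewrite row_mul rowK -nE rowE -scalemx1 -scalemxAr.
  by rewrite mulmx1.
have MN : M *m N = Q%:M.
  apply/eqP; rewrite -subr_eq0; apply/eqP/row_matrixP => i; rewrite row0.
  apply: indep; rewrite -row_mul mulmxBl -mulmxA NM mul_mx_scalar mul_scalar_mx.
  by rewrite subrr row0.
(* The number r of basis elements is not given to be l. The traces of [M *m N] and [N *m M] are rQ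
   and lQ, and characteristic zero separates the integers. *)
have rl : r = l.
  apply: natr_inj_char0; have := mxtrace_mulC M N; rewrite MN NM !mxtrace_scalar.
  rewrite -[Q *+ r]mulr_natr -[Q *+ l]mulr_natr => /(mulfI arrangement_poly_neq0).
  by move/(congr1 (mcoeff 0%MM)); rewrite -!mpolyC_nat !mcoeffC eqxx !mulr1.
have logM i : log_row (row i M).
  have -> : row i M = \row_j b i 'X_j by apply/rowP => j; rewrite !mxE.
  exact: in_D_log_row (bD i).
clearbody M; clear b bD bB indep n nE N NM MN.
move: M span logM; rewrite rl => M span logM.
have [u detM] := log_det_dvdr logM.
have nu H : H \in E -> ~ dvdr (L H) u.
  move=> HE Hu; have [d [c [c0 dE]]] := log_det_cofactor HE span.
  have : dvdr (L H) ((c%:MP * \prod_(y <- rem H E) L y) ^+ l.-1).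
    have -> : (c%:MP * \prod_(y <- rem H E) L y) ^+ l.-1 = d * u.
      by apply: (mulfI arrangement_poly_neq0); rewrite -dE detM mulrCA.
    exact: dvdrMr.
  have pH := arrangement_prime HE.
  move/(prime_elt_exp pH)/pH.2 => [[q qE]|/(prime_elt_prod pH)[H' HE' /arrangement_coprime]].
    by apply: pH.1; exists (q * (c^-1)%:MP); rewrite mulrA -qE -mpolyCM mulfV.
  move: HE'; rewrite mem_rem_uniq ?fset_uniq // inE => /andP[neq HE'].
  by apply; rewrite // eq_sym.
have [d [c [c0 dE]]] := log_det_cofactor HE0 span.
(* The cofactor identity makes [u] divide a nonzero constant times a power of Q. No form of E
   divides [u], so all of them cancel and only the constant is left. *)
have /(mpoly_dvd_const (expf_neq0 l.-1 c0))[e e0 uE] : dvdr u (c ^+ l.-1)%:MP.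
  have : dvdr u ((c ^+ l.-1)%:MP * Q ^+ l.-1).
    have [w wE] : dvdr (\prod_(y <- rem H0 E) L y) Q.
      by rewrite [Q](big_rem H0) //= mulrC; apply: dvdrMl; apply: dvdr_refl.
    have -> : (c ^+ l.-1)%:MP = c%:MP ^+ l.-1 :> S by exact: rmorphXn.
    rewrite {1}wE exprMn mulrA -exprMn; apply: dvdrMl; exists d.
    by apply: (mulfI arrangement_poly_neq0); rewrite -dE detM mulrCA [d * u]mulrC.
  elim: (l.-1) {dE} (c ^+ _) => [|k IH] x; first by rewrite mulr1.
  rewrite exprSr mulrA => h; apply: IH.
  apply: (dvdr_cancel_primes (s := E) (F := fun H => L H)) h => //.
    exact: arrangement_form_neq0.
  exact: arrangement_prime.
by exists M, e; split=> //; rewrite detM uE mulrC.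
Qed.

End Saito.

(** * Power sum relations *)

(** The relation of the diagonal case, multiplied by q^2 after putting p = k/q and with negative
    terms moved across. For k = 3, q = 3 both sides equal 315; for k >= 5 the difference of the
    sides has positive coefficients in k - 5 and q, and k = 4 is computed. *)
Lemma diagonal_count_neq k q : (4 <= k)%N -> q = (2 ^ k.-1).-1 ->
  (q ^ 2 * (k ^ 2 + 14) + 3 * k ^ 2 + 3 * k ^ 2 * q)%N !=
  (7 * k * q ^ 2 + 14 * k * q)%N.
Proof.
move=> k4 qE; have [k5|k5] := eqVneq k 4%N; first by rewrite qE k5.
have {k4}k5 : (5 <= k)%N by lia.
have q0 : (0 < q)%N.
  have : (2 ^ 1 < 2 ^ k.-1)%N by rewrite ltn_exp2l //; lia.
  by rewrite qE expn1; lia.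
have -> : k = (k - 5 + 5)%N by lia.
move: (k - 5)%N => d.
have -> : (q ^ 2 * ((d + 5) ^ 2 + 14) + 3 * (d + 5) ^ 2 + 3 * (d + 5) ^ 2 * q =
  7 * (d + 5) * q ^ 2 + 14 * (d + 5) * q +
  (q ^ 2 * (d ^ 2 + 3 * d + 4) + (3 * d ^ 2 + 16 * d + 5) * q + 3 * (d + 5) ^ 2))%N by ring.
by rewrite -[X in _ != X]addn0 eqn_add2l -lt0n !addn_gt0 !muln_gt0 q0 !addn_gt0 !orbT.
Qed.

(** The relation of the vertical case, multiplied by q^4 with p = k/q: here x - y is q^2 (p (p + k)
    - 2) and (k - 3) q + 2k is q (k + 2p - 3). The square of x - y is expanded so that all terms are
    natural numbers. For k = 3 equality holds. *)
Lemma vertical_count_neq k q x y : (4 <= k)%N -> q = (2 ^ k.-1).-1 ->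
  x = (k ^ 2 + k ^ 2 * q)%N -> y = (2 * q ^ 2)%N ->
  (4 * q * ((k - 3) * q + 2 * k) ^ 3 + (k ^ 2).-1 * (2 * x * y))%N !=
  ((k ^ 2).-1 * (x ^ 2 + y ^ 2))%N.
Proof.
move=> k4 qE xE yE.
have [k7|k7] := leqP 7 k; last first.
  (* With M = (k - 3) q + 2k, a bound |x - y| <= 2cM reduces the strict inequality to (k^2 - 1) c^2
     < qM. The least positive c that works is 1, 1, 4 for k = 4, 5, 6. *)
  have small c : (0 < q)%N -> ((k ^ 2).-1 * c ^ 2 < q * ((k - 3) * q + 2 * k))%N ->
      (x <= y + 2 * c * ((k - 3) * q + 2 * k))%N ->
      (y <= x + 2 * c * ((k - 3) * q + 2 * k))%N ->
      (4 * q * ((k - 3) * q + 2 * k) ^ 3 + (k ^ 2).-1 * (2 * x * y))%N !=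
      ((k ^ 2).-1 * (x ^ 2 + y ^ 2))%N.
    move: (_ * q + _)%N (_.-1)%N => M w q0 wM xM yM; rewrite neq_ltn; apply/orP; right.
    have xy : (x ^ 2 + y ^ 2 <= 2 * x * y + (2 * c * M) ^ 2)%N.
      by move: (2 * c * M)%N xM yM => z; clear; rewrite !expnS !expn0; nia.
    apply: (@leq_ltn_trans (w * (2 * x * y + (2 * c * M) ^ 2))%N).
      by rewrite leq_mul2l xy orbT.
    rewrite mulnDr addnC ltn_add2r.
    have -> : (w * (2 * c * M) ^ 2 = w * c ^ 2 * (4 * M ^ 2))%N by ring.
    have -> : (4 * q * M ^ 3 = q * M * (4 * M ^ 2))%N by ring.
    rewrite ltn_pmul2r // muln_gt0 /= expn_gt0.
    by case: M wM {xM yM xy} => //; rewrite muln0.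
  have [k4'|[k5|k6]] : k = 4%N \/ k = 5%N \/ k = 6%N by lia.
  - have qv : q = 7%N by rewrite qE k4'.
    by apply: (small 1%N); rewrite ?yE ?xE ?qv ?k4'.
  - have qv : q = 15%N by rewrite qE k5.
    by apply: (small 1%N); rewrite ?yE ?xE ?qv ?k5.
  - have qv : q = 31%N by rewrite qE k6.
    by apply: (small 4%N); rewrite ?yE ?xE ?qv ?k6.
(* From k = 7 on, k^2 <= q + 1, hence x <= 2y and (x - y)^2 <= y^2; what remains is k^2 - 1 < (k -
   3)^3. *)
have hk : (k ^ 2 <= 2 ^ k.-1)%N.
  rewrite -(subnK k7); elim: (k - 7)%N => [|d IH] //.
  have -> : (2 ^ (d.+1 + 7).-1 = 2 * 2 ^ (d + 7).-1)%N by rewrite -expnS; congr expn; lia.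
  by move: IH; set z := (2 ^ _)%N; rewrite !expnS !expn0; nia.
have q1 : (q.+1 = 2 ^ k.-1)%N by rewrite qE prednK // expn_gt0.
rewrite -q1 in hk; clear qE q1.
have xy : (x <= 2 * y)%N.
  have : (k ^ 2 * q.+1 <= q.+1 * q.+1)%N by rewrite leq_mul2r hk orbT.
  by rewrite xE yE !expnS !expn0 in hk *; nia.
have q0 : (0 < q)%N by move: hk; rewrite !expnS expn0; nia.
rewrite neq_ltn; apply/orP; right.
apply: (@leq_ltn_trans ((k ^ 2).-1 * (2 * x * y) + (k ^ 2).-1 * y ^ 2)%N).
  rewrite -mulnDr leq_mul2l; apply/orP; right.
  rewrite [(x ^ 2)%N]expnS expn1 leq_add2r -mulnA mulnCA leq_mul2l; apply/orP; right.
  by [].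
rewrite addnC ltn_add2r {xy xE x}yE.
have -> : ((2 * q ^ 2) ^ 2 = 4 * q * q ^ 3)%N by ring.
rewrite mulnCA -!mulnA !ltn_pmul2l //.
apply: (@leq_trans ((k - 3) ^ 3 * q ^ 3)%N); last by rewrite -expnMn leq_exp2r // leq_addr.
rewrite ltn_pmul2r ?expn_gt0 ?q0 //; move: k7; clear; rewrite !expnS !expn0 => k7.
have -> : k = (k - 7 + 7)%N by lia.
by move: (k - 7)%N => d; nia.
Qed.

Section Relations.
Variable K : fieldType.
Implicit Types (k p A b t x y : K).

(** Passes from one equation to a consequence by a scalar multiple, leaving a single identity for
    [ring] or [field]. *)
Lemma eq_multiple (c x y l r : K) : l = r -> x - y = c * (l - r) -> x = y.
Proof. by move=> ->; rewrite subrr mulr0 => /eqP; rewrite subr_eq0 => /eqP. Qed.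

(** The case of a common zero on x = y, where the power sums of C are 2 b1, 4 b2, 8 b3 and A runs
    over the shifted vertical lines. Degree one gives b1 = 0. Degree two makes A^2 the same for both
    lines, so A1 = -A2. In degree three the value of 7 b3 is odd in A, hence its coefficient
    vanishes. *)
Lemma diagonal_relation k p A1 A2 b1 b2 b3 :
  A1 != A2 -> k != 0 -> 2 != 0 :> K -> k + 2 * p - 3 != 0 ->
  (forall A, A = A1 \/ A = A2 -> [/\
    b1 - (p + k - 1) * A = 2 * b1 - k * A - (p - 1) * A,
    b2 + ((p + k - 1) * A) ^+ 2 =
      4 * b2 - 2 * A * (2 * b1) + k * A ^+ 2 + ((p - 1) * A) ^+ 2 &
    b3 - ((p + k - 1) * A) ^+ 3 =
      8 * b3 - 3 * A * (4 * b2) + 3 * A ^+ 2 * (2 * b1) - k * A ^+ 3 - ((p - 1) * A) ^+ 3]) ->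
  k ^+ 2 - 7 * k + 14 + 3 * p ^+ 2 + 3 * p * k - 14 * p = 0.
Proof.
move=> neqA k0 two0 M0 h.
have b10 : b1 = 0.
  have [e1 _ _] := h A1 (or_introl erefl).
  by apply: (eq_multiple (c := -1) e1); ring.
pose c2 := k * (k + 2 * p - 3).
pose z := k ^+ 2 - 7 * k + 14 + 3 * p ^+ 2 + 3 * p * k - 14 * p.
have f2 A : A = A1 \/ A = A2 -> 3 * b2 = A ^+ 2 * c2.
  case/h => _ e2 _; apply: (eq_multiple (c := -1) e2).
  by rewrite b10 /c2; ring.
have f3 A : A = A1 \/ A = A2 -> 7 * b3 = - A ^+ 3 * (k * z).
  move=> hA; have [_ _ e3] := h A hA.
  have -> : 7 * b3 = 4 * A * (3 * b2) + A ^+ 3 * (k + (p - 1) ^+ 3 - (p + k - 1) ^+ 3).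
    by apply: (eq_multiple (c := -1) e3); rewrite b10; ring.
  by rewrite (f2 A hA) /c2 /z; ring.
have c20 : c2 != 0 by rewrite mulf_neq0.
have i1 : A1 = A1 \/ A1 = A2 by left.
have i2 : A2 = A1 \/ A2 = A2 by right.
have /eqP : A1 ^+ 2 = A2 ^+ 2 by apply: (mulIf c20); rewrite -f2 // -f2.
rewrite eqf_sqr (negPf neqA) => /= /eqP AE.
have A20 : A2 != 0 by apply: contraNneq neqA => A20; rewrite AE A20 oppr0.
have e : 2 * A2 ^+ 3 * k * z = 0.
  have := f3 A1 i1; rewrite (f3 A2 i2) AE => e.
  by apply: (eq_multiple (c := -1) e); ring.
by apply: (mulfI (x := 2 * A2 ^+ 3 * k)); rewrite ?mulr0 // !mulf_neq0 ?expf_neq0.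
Qed.

(** The case of a common zero on one vertical line: there B and C have equal power sums, and A is
    the offset of the other vertical line. The diagonal equations express b1 and b2 through v = t /
    (p (p + k)). The degree two and three equations on the other line give 2vD = -AM and 16 v^2 M =
    A^2 (k^2 - 1); eliminating v/A leaves a relation in k and p. *)
Lemma vertical_relation k p A b1 b2 b3 t :
  A != 0 -> k != 0 -> 2 != 0 :> K -> p != 0 -> p + k != 0 -> k + 2 * p - 3 != 0 ->
  b1 / 2 - t / p = b1 - t / (p + k) ->
  b2 / 4 + (t / p) ^+ 2 = b2 + (t / (p + k)) ^+ 2 ->
  b2 + (t + (p + k - 1) * A) ^+ 2 =
    b2 - 2 * A * b1 + k * A ^+ 2 + (t + (p - 1) * A) ^+ 2 ->
  b3 - (t + (p + k - 1) * A) ^+ 3 =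
    b3 - 3 * A * b2 + 3 * A ^+ 2 * b1 - k * A ^+ 3 - (t + (p - 1) * A) ^+ 3 ->
  4 * (k + 2 * p - 3) ^+ 3 = (k ^+ 2 - 1) * (p * (p + k) - 2) ^+ 2.
Proof.
move=> A0 k0 two0 p0 g0 M0 d1 d2 e2 e3.
have four0 : 4 != 0 :> K by rewrite (_ : 4 = 2 * 2) ?mulf_neq0 //; ring.
pose v := t / (p * (p + k)).
have tE : t = v * p * (p + k) by rewrite /v; field; rewrite p0 g0.
have rE : t / p = v * (p + k) by rewrite /v; field; rewrite p0 g0.
have wE : t / (p + k) = v * p by rewrite /v; field; rewrite p0 g0.
move: d1 d2; rewrite rE wE => d1 d2.
have b1E : b1 = - (2 * k * v).
  by apply: (eq_multiple (c := - 2) d1); field.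
have b2E : 3 * b2 = 4 * v ^+ 2 * k * (k + 2 * p).
  by apply: (eq_multiple (c := - 4) d2); field.
pose D := p * (p + k) - 2; pose M := k + 2 * p - 3.
have vD : 2 * v * D = - (A * M).
  apply: (mulfI (mulf_neq0 k0 A0)).
  apply: (eq_multiple (c := 1) e2).
  by rewrite b1E tE /D /M; ring.
have vM : 16 * v ^+ 2 * M = A ^+ 2 * (k ^+ 2 - 1).
  have e3' : A * (3 * b2) = 3 * A ^+ 2 * b1 - k * A ^+ 3
      + (t + (p + k - 1) * A) ^+ 3 - (t + (p - 1) * A) ^+ 3.
    by apply: (eq_multiple (c := 1) e3); ring.
  have tE' : 2 * t = - (A * M) + 4 * v.
    by apply: (eq_multiple (c := 1) vD); rewrite tE /D; ring.
  have tE2 : t = (- (A * M) + 4 * v) / 2 by rewrite -tE'; field.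
  apply: (mulfI (mulf_neq0 k0 A0)).
  rewrite b2E b1E tE2 in e3'; apply: (eq_multiple (c := 4) e3').
  by rewrite /M; field.
have e : A ^+ 2 * (4 * M ^+ 3) = A ^+ 2 * ((k ^+ 2 - 1) * D ^+ 2).
  rewrite [RHS]mulrA -vM; have := congr1 (fun x => x ^+ 2) vD => e.
  by apply: (eq_multiple (c := - (4 * M)) e); ring.
by apply: (mulfI _ e); rewrite expf_neq0.
Qed.

End Relations.

Section Pencil.
Variable K : fieldType.
Hypothesis char0 : [pchar K] =i pred0.
Implicit Types (B C s : seq K).

Local Notation split s := (\prod_(z <- s) ('X - z%:P)).

Lemma natr_neq0_char0 n : (0 < n)%N -> n%:R != 0 :> K.
Proof. by rewrite (pcharf0P K).1 // -lt0n. Qed.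

Lemma coef_split_linear s u v : s != [::] ->
  let f := split s * (u%:P + v *: 'X) in
  f`_(size s).+1 = v /\ f`_(size s) = u - v * \sum_(z <- s) z.
Proof.
move=> s0 f; have s0' : size s != 0%N by case: (s) s0.
have fE i : f`_i.+1 = (split s)`_i.+1 * u + v * (split s)`_i.
  by rewrite /f mulrDr coefD coefMC -scalerAr coefZ coefMX.
have monic_s : (split s)`_(size s) = 1.
  by have /monicP := monic_prod_XsubC s predT id; rewrite lead_coefE size_prod_XsubC.
split; first by rewrite fE monic_s nth_default ?size_prod_XsubC // mul0r add0r mulr1.
have := coefPn_prod_XsubC s0'; move: s0' monic_s; case: (size s) => // d _ monic_s h.
by rewrite fE monic_s h mul1r mulrN.
Qed.

(** By unique factorization the two root multisets coincide, so any symmetric sum over them does; it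
    is applied to the first three powers. *)
Lemma split_power_sums B C r r' : split B * ('X - r%:P) = split C * ('X - r'%:P) ->
  forall h : K -> K, \sum_(b <- B) h b + h r = \sum_(c <- C) h c + h r'.
Proof.
move=> e h; have : split (r :: B) = split (r' :: C) by rewrite !big_cons mulrC e mulrC.
move/prod_XsubC_eq => BC.
have : \sum_(z <- r :: B) h z = \sum_(z <- r' :: C) h z by exact: perm_big.
by rewrite !big_cons addrC => ->; rewrite addrC.
Qed.

Lemma sum_shift_exp s a :
  [/\ \sum_(z <- s) (z - a) = \sum_(z <- s) z - (size s)%:R * a,
      \sum_(z <- s) (z - a) ^+ 2 =
        \sum_(z <- s) z ^+ 2 - 2 * a * (\sum_(z <- s) z) + (size s)%:R * a ^+ 2 &
      \sum_(z <- s) (z - a) ^+ 3 =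
        \sum_(z <- s) z ^+ 3 - 3 * a * (\sum_(z <- s) z ^+ 2)
        + 3 * a ^+ 2 * (\sum_(z <- s) z) - (size s)%:R * a ^+ 3].
Proof.
elim: s => [|z s [IH1 IH2 IH3]]; first by rewrite !big_nil /=; split; ring.
by rewrite !big_cons IH1 IH2 IH3 /= -[(size s).+1%:R]natr1; split; ring.
Qed.

(* The coordinates are shifted so that the common zero [(x0, y0)] of the two
   linear forms becomes the origin. *)
Lemma no_normalized_pencil k B C (a1 a2 p g0 p0 x0 y0 : K) :
  (4 <= k)%N -> size B = k -> size C = k -> a1 != a2 ->
  p * (2 ^ k.-1).-1%:R = k%:R ->
  (forall a, a = a1 \/ a = a2 -> forall h : K -> K,
     \sum_(b <- B) h b + h (- (g0 + (p + k%:R - 1) * a)) =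
     \sum_(c <- C) h (c - a) + h (- (p0 + (p - 1) * a))) ->
  (forall h : K -> K,
     \sum_(c <- C) h (c / 2) + h (- (p0 / p)) =
     \sum_(b <- B) h b + h (- (g0 / (p + k%:R)))) ->
  g0 + (p + k%:R - 1) * x0 + y0 = 0 -> p0 + (p - 1) * x0 + y0 = 0 ->
  [\/ x0 = a1, x0 = a2 | x0 = y0] -> False.
Proof.
move=> k4 sB sC neqa pq vert diag zg zp x0E.
set q := (2 ^ k.-1).-1 in pq.
have two0 : 2 != 0 :> K := natr_neq0_char0 (isT : 0 < 2)%N.
have kK0 : k%:R != 0 :> K by apply: natr_neq0_char0; lia.
have q0 : q%:R != 0 :> K by apply: contraNneq kK0 => q0; rewrite -pq q0 mulr0.
have p0' : p != 0 by apply: contraNneq kK0 => p0'; rewrite -pq p0' mul0r.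
have gq : (p + k%:R) * q%:R = (k + k * q)%:R by rewrite mulrDl pq natrD natrM.
have g0' : p + k%:R != 0.
  have : (k + k * q)%:R != 0 :> K by apply: natr_neq0_char0; lia.
  by apply: contraNneq => g0'; rewrite -gq g0' mul0r.
have Mq : (k%:R + 2 * p - 3) * q%:R = ((k - 3) * q + 2 * k)%:R.
  rewrite natrD !natrM natrB; last by lia.
  by apply: (eq_multiple (c := 2) pq); ring.
have M0 : k%:R + 2 * p - 3 != 0.
  have : ((k - 3) * q + 2 * k)%:R != 0 :> K.
    by apply: natr_neq0_char0; rewrite addn_gt0; apply/orP; right; lia.
  by apply: contraNneq => M0; rewrite -Mq M0 mul0r.
(* The translation is by (x0, x0), which preserves the diagonal; the common zero becomes (0, y0 -
   x0). Both constant terms become x0 - y0, so g' and p' agree, and they vanish exactly when the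
   zero lies on the diagonal. *)
pose B' := [seq b - x0 | b <- B]; pose C' := [seq c - 2 * x0 | c <- C].
pose g' := g0 + (p + k%:R) * x0; pose p' := p0 + p * x0.
have vert' a : a = a1 \/ a = a2 -> forall h : K -> K,
     \sum_(b <- B') h b + h (- (g' + (p + k%:R - 1) * (a - x0))) =
     \sum_(c <- C') h (c - (a - x0)) + h (- (p' + (p - 1) * (a - x0))).
  move=> ha h; have := vert a ha (fun y => h (y - x0)); rewrite !big_map.
  have -> : - (g0 + (p + k%:R - 1) * a) - x0 = - (g' + (p + k%:R - 1) * (a - x0)).
    by rewrite /g'; ring.
  have -> : - (p0 + (p - 1) * a) - x0 = - (p' + (p - 1) * (a - x0)).
    by rewrite /p'; ring.
  by move=> ->; congr (_ + _); apply: eq_bigr => c _; congr h; ring.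
have diag' (h : K -> K) : \sum_(c <- C') h (c / 2) + h (- (p' / p)) =
     \sum_(b <- B') h b + h (- (g' / (p + k%:R))).
  have := diag (fun y => h (y - x0)); rewrite !big_map.
  have -> : - (p0 / p) - x0 = - (p' / p) by rewrite /p'; field.
  have -> : - (g0 / (p + k%:R)) - x0 = - (g' / (p + k%:R)) by rewrite /g'; field.
  by move=> <-; congr (_ + _); apply: eq_bigr => c _; congr h; field.
have sC' : size C' = k by rewrite size_map.
have pg : p' = g'.
  apply/eqP; rewrite -subr_eq0; apply/eqP; transitivity (p0 + (p - 1) * x0 + y0 -
    (g0 + (p + k%:R - 1) * x0 + y0)); last by rewrite zg zp subrr.
  by rewrite /p' /g'; ring.
pose b1 := \sum_(b <- B') b; pose b2 := \sum_(b <- B') b ^+ 2.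
pose b3 := \sum_(b <- B') b ^+ 3.
pose c1 := \sum_(c <- C') c; pose c2 := \sum_(c <- C') c ^+ 2.
pose c3 := \sum_(c <- C') c ^+ 3.
have cubeN (y : K) : (- y) ^+ 3 = - y ^+ 3 by ring.
have V a : a = a1 \/ a = a2 -> [/\
    b1 - (g' + (p + k%:R - 1) * (a - x0)) =
      c1 - k%:R * (a - x0) - (p' + (p - 1) * (a - x0)),
    b2 + (g' + (p + k%:R - 1) * (a - x0)) ^+ 2 =
      c2 - 2 * (a - x0) * c1 + k%:R * (a - x0) ^+ 2 + (p' + (p - 1) * (a - x0)) ^+ 2 &
    b3 - (g' + (p + k%:R - 1) * (a - x0)) ^+ 3 =
      c3 - 3 * (a - x0) * c2 + 3 * (a - x0) ^+ 2 * c1 - k%:R * (a - x0) ^+ 3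
      - (p' + (p - 1) * (a - x0)) ^+ 3].
  move=> ha; have [S1 S2 S3] := sum_shift_exp C' (a - x0); rewrite sC' in S1 S2 S3.
  split.
  - by have := vert' a ha id; rewrite /= S1.
  - by have := vert' a ha (fun y => y ^+ 2); rewrite /= S2 !sqrrN.
  by have := vert' a ha (fun y => y ^+ 3); rewrite /= S3 !cubeN.
have [D1 D2 D3] : [/\ c1 / 2 - p' / p = b1 - g' / (p + k%:R),
   c2 / 4 + (p' / p) ^+ 2 = b2 + (g' / (p + k%:R)) ^+ 2 &
   c3 / 8 - (p' / p) ^+ 3 = b3 - (g' / (p + k%:R)) ^+ 3].
  have e4 : 2 ^+ 2 = 4 :> K by ring.
  have e8 : 2 ^+ 3 = 8 :> K by ring.
  split.
  - by have := diag' id; rewrite /= -mulr_suml.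
  - have := diag' (fun y => y ^+ 2); rewrite /= !sqrrN => <-; congr (_ + _).
    by rewrite mulr_suml; apply: eq_bigr => c _; rewrite expr_div_n e4.
  have := diag' (fun y => y ^+ 3); rewrite /= !cubeN => <-.
  by congr (_ - _); rewrite mulr_suml; apply: eq_bigr => c _; rewrite expr_div_n e8.
rewrite {}pg in V D1 D2 D3.
(* On the vertical line through the common zero the offset is 0, so the restriction there equates
   the power sums of B' and C'; the other vertical line carries the information. *)
have vertical a a' : x0 = a -> (a' = a1 \/ a' = a2) -> (a = a1 \/ a = a2) ->
    a != a' -> False.
  move=> x0a ha' ha naa.
  have [U1 U2 U3] := V a ha; rewrite -x0a subrr in U1 U2 U3.
  have c1E : c1 = b1 by apply: (eq_multiple (c := -1) U1); ring.
  have c2E : c2 = b2 by apply: (eq_multiple (c := -1) U2); ring.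
  have c3E : c3 = b3 by apply: (eq_multiple (c := -1) U3); ring.
  have [W1 W2 W3] := V a' ha'; rewrite c1E c2E c3E in W1 W2 W3 D1 D2.
  have A0 : a' - x0 != 0 by rewrite x0a subr_eq0 eq_sym.
  have := vertical_relation A0 kK0 two0 p0' g0' M0 D1 D2 W2 W3.
  move/(congr1 (fun z => z * q%:R ^+ 4)) => e.
  pose u : K := (k ^ 2 + k ^ 2 * q)%:R; pose w : K := (2 * q ^ 2)%:R.
  have uw : (p * (p + k%:R) - 2) * q%:R ^+ 2 = u - w.
    have -> : (p * (p + k%:R) - 2) * q%:R ^+ 2 =
      (p * q%:R) * (p * q%:R + k%:R * q%:R) - 2 * q%:R ^+ 2 by ring.
    by rewrite pq /u /w natrD !natrM; ring.
  have k2 : (k ^ 2).-1%:R = k%:R ^+ 2 - 1 :> K.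
    by rewrite -subn1 natrB; [rewrite natrX | rewrite expn_gt0 (leq_trans _ k4)].
  have {}e : 4 * q%:R * ((k - 3) * q + 2 * k)%:R ^+ 3 = (k ^ 2).-1%:R * (u - w) ^+ 2 :> K.
    by rewrite -Mq -uw k2; apply: (eq_multiple (c := 1) e); ring.
  have /eqP := vertical_count_neq k4 (erefl q) (erefl _) (erefl _); apply.
  apply: (natr_inj_char0 char0); move: e; rewrite /u /w; move: (k ^ 2).-1 => l.
  move: ((k - 3) * q + 2 * k)%N (k ^ 2 + k ^ 2 * q)%N (2 * q ^ 2)%N => M x y e.
  by rewrite !(natrD, natrM, natrX); apply: (eq_multiple (c := 1) e); ring.
have i1 : a1 = a1 \/ a1 = a2 by left.
have i2 : a2 = a1 \/ a2 = a2 by right.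
case: x0E => [e|e|e].
- exact: vertical e i2 i1 neqa.
- by apply: vertical e i1 i2 _; rewrite eq_sym.
(* With both constant terms zero, the diagonal restriction says that halving maps the power sums of
   C' to those of B'. *)
have g'0 : g' = 0 by rewrite -zg -e /g'; ring.
rewrite g'0 !mul0r !subr0 ?expr0n ?addr0 ?subr0 /= in D1 D2 D3.
have c1E : c1 = 2 * b1 by rewrite -D1; field.
have four0 : 4 != 0 :> K := natr_neq0_char0 (isT : 0 < 4)%N.
have eight0 : 8 != 0 :> K := natr_neq0_char0 (isT : 0 < 8)%N.
have c2E : c2 = 4 * b2 by rewrite -D2; field.
have c3E : c3 = 8 * b3 by rewrite -D3; field.
have neqA : a1 - x0 != a2 - x0 by rewrite (inj_eq (addIr _)).
have e0 : k%:R ^+ 2 - 7 * k%:R + 14 + 3 * p ^+ 2 + 3 * p * k%:R - 14 * p = 0.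
  apply: (diagonal_relation (b1 := b1) (b2 := b2) (b3 := b3) neqA kK0 two0 M0) => A hA.
  have [a ha ->] : exists2 a, a = a1 \/ a = a2 & A = a - x0.
    by case: hA => ->; [exists a1 | exists a2].
  by have := V a ha; rewrite c1E c2E c3E g'0 !add0r.
have := congr1 (fun z => z * q%:R ^+ 2) e0; rewrite /= mul0r => e'.
have /eqP := diagonal_count_neq k4 (erefl q); apply.
apply: (natr_inj_char0 char0); rewrite !(natrD, natrM, natrX) -pq.
by rewrite -pq in e'; apply: (eq_multiple (c := 1) e'); ring.
Qed.

End Pencil.

(** * Planar tangent fields *)

Section Pencil.
Variable K : fieldType.
Hypothesis char0 : [pchar K] =i pred0.
Implicit Types (B C s : seq K).

Local Notation split s := (\prod_(z <- s) ('X - z%:P)).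

Lemma linear_poly_monic (u v : K) : v != 0 ->
  u%:P + v *: 'X = v *: ('X - (- (u / v))%:P).
Proof.
by move=> v0; rewrite polyCN opprK scalerDr addrC scale_polyC [v * _]mulrC divfK.
Qed.

Lemma prod_double s : 2 != 0 :> K ->
  \prod_(c <- s) (2 *: 'X - c%:P) = 2 ^+ size s *: split [seq c / 2 | c <- s].
Proof.
move=> two0; elim: s => [|c s IH]; first by rewrite !big_nil scale1r.
rewrite /= !big_cons IH; have -> : 2 *: 'X - c%:P = 2 *: ('X - (c / 2)%:P).
  by rewrite scalerBr scale_polyC mulrCA mulfV ?mulr1.
by rewrite -scalerAl -scalerAr scalerA -exprS.
Qed.

(** The hypotheses are the restrictions to the three lines for G = g0 + g1 x + g2 y and P = p0 + p1
    x + p2 y. Their top two coefficients give g2 = p2, g1 = p1 + k g2 and 2^k (p1 + g2) = 2 (g1 +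
    g2). If g2 = 0 these force G = P = 0, as 2^k differs from 2; otherwise dividing by g2 gives the
    normalized situation. *)
Lemma no_common_pencil k B C (a1 a2 g0 g1 g2 p0 p1 p2 : K) :
  (4 <= k)%N -> size B = k -> size C = k -> a1 != a2 ->
  (forall a, a = a1 \/ a = a2 ->
     split B * ((g0 + g1 * a)%:P + g2 *: 'X) =
     \prod_(c <- C) ('X - (c - a)%:P) * ((p0 + p1 * a)%:P + p2 *: 'X)) ->
  \prod_(c <- C) (2 *: 'X - c%:P) * (p0%:P + (p1 + p2) *: 'X) =
    2 *: (split B * (g0%:P + (g1 + g2) *: 'X)) ->
  (forall x y, g0 + g1 * x + g2 * y = 0 -> p0 + p1 * x + p2 * y = 0 ->
     [\/ x = a1, x = a2 | x = y]) ->
  (g0 = 0 /\ g1 = 0 /\ g2 = 0) /\ (p0 = 0 /\ p1 = 0 /\ p2 = 0).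
Proof.
move=> k4 sB sC neqa vert diag zero.
have two0 : 2 != 0 :> K := natr_neq0_char0 char0 (isT : 0 < 2)%N.
have kK0 : k%:R != 0 :> K by apply: (natr_neq0_char0 char0); lia.
have q2 : 2 * (2 ^ k.-1)%:R = 2 ^+ k :> K.
  by rewrite natrX -exprS prednK //; lia.
have q1 : (2 ^ k.-1).-1%:R = (2 ^ k.-1)%:R - 1 :> K.
  by rewrite -subn1 natrB // expn_gt0.
have q0 : (2 ^ k.-1).-1%:R != 0 :> K.
  apply: (natr_neq0_char0 char0); have : (2 ^ 1 < 2 ^ k.-1)%N by rewrite ltn_exp2l //; lia.
  by rewrite expn1; lia.
have B0 : B != [::] by apply/eqP => B0; move: sB k4; rewrite B0 /= => <-.
have C0 : C != [::] by apply/eqP => C0; move: sC k4; rewrite C0 /= => <-.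
pose Cs a := [seq c - a | c <- C]; pose Ch := [seq c / 2 | c <- C].
have sCs a : size (Cs a) = k by rewrite size_map.
have Cs0 a : Cs a != [::] by rewrite -size_eq0 sCs -lt0n; lia.
have sCh : size Ch = k by rewrite size_map.
have Ch0 : Ch != [::] by rewrite -size_eq0 sCh -lt0n; lia.
have CsE a : \prod_(c <- C) ('X - (c - a)%:P) = split (Cs a) by rewrite big_map.
have ChE : \prod_(c <- C) (2 *: 'X - c%:P) = 2 ^+ k *: split Ch.
  by rewrite prod_double // sC.
pose sb := \sum_(b <- B) b; pose sc := \sum_(c <- C) c.
have sumCs a : \sum_(c <- Cs a) c = sc - k%:R * a.
  by rewrite big_map; have [-> _ _] := sum_shift_exp C a; rewrite sC.
have sumCh : \sum_(c <- Ch) c = sc / 2 by rewrite big_map -mulr_suml.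
have top a : a = a1 \/ a = a2 -> g2 = p2 /\
    g0 + g1 * a - g2 * sb = p0 + p1 * a - p2 * (sc - k%:R * a).
  move=> /vert; rewrite CsE => e.
  have [/= e1 e2] := coef_split_linear (g0 + g1 * a) g2 B0.
  have [/= e3 e4] := coef_split_linear (p0 + p1 * a) p2 (Cs0 a).
  rewrite e sB in e1 e2; rewrite sCs in e3 e4.
  split; first exact: etrans (esym e1) e3.
  by rewrite -sumCs; apply: etrans (esym e2) e4.
have [gp2 t1] := top a1 (or_introl erefl); have [_ t2] := top a2 (or_intror erefl).
rewrite -gp2 in t1 t2 *.
have g1E : g1 = p1 + g2 * k%:R.
  have a0 : a1 - a2 != 0 by rewrite subr_eq0.
  apply: (mulIf a0); transitivity (g0 + g1 * a1 - g2 * sb - (g0 + g1 * a2 - g2 * sb)).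
    by ring.
  by rewrite t1 t2; ring.
rewrite ChE -gp2 -scalerAl in diag.
have [d1 d2] : 2 ^+ k * (p1 + g2) = 2 * (g1 + g2) /\
    2 ^+ k * (p0 - (p1 + g2) * (sc / 2)) = 2 * (g0 - (g1 + g2) * sb).
  have [/= e1 e2] := coef_split_linear g0 (g1 + g2) B0.
  have [/= e3 e4] := coef_split_linear p0 (p1 + g2) Ch0.
  rewrite sB in e1 e2; rewrite sCh sumCh in e3 e4.
  rewrite -/sb in e2; split; first by rewrite -e1 -e3 -!coefZ diag.
  by rewrite -e2 -e4 -!coefZ diag.
have [g20|g20] := eqVneq g2 0.
  rewrite g20 !mul0r !addr0 in g1E d1 d2 t1 *.
  have p10 : p1 = 0.
    apply: (mulfI (mulf_neq0 two0 q0)).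
    apply: (eq_multiple (c := 1) d1); rewrite -q2 q1 g1E; ring.
  rewrite {}g1E {}p10 !mul0r !addr0 !subr0 in t1 d2 *.
  suff p00 : p0 = 0 by rewrite t1 p00.
  apply: (mulfI (mulf_neq0 two0 q0)).
  by apply: (eq_multiple (c := 1) d2); rewrite -q2 q1 t1; ring.
exfalso.
pose p := (p1 + g2) / g2.
have pq : p * (2 ^ k.-1).-1%:R = k%:R.
  apply: (mulfI (mulf_neq0 two0 g20)).
  apply: (eq_multiple (c := 1) d1); rewrite q1 -q2 g1E /p; field.
  by [].
have p0' : p != 0 by apply: contraNneq kK0 => p0'; rewrite -pq p0' mul0r.
have gE : (g1 + g2) / g2 = p + k%:R by rewrite g1E /p; field.
have pE : p1 + g2 = g2 * p by rewrite /p mulrC divfK.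
have gE' : g1 + g2 = g2 * (p + k%:R) by rewrite -gE mulrC divfK.
have two_k : 2 ^+ k != 0 :> K by rewrite expf_neq0.
have g0' : p + k%:R != 0.
  apply: contraNneq (mulf_neq0 two_k (mulf_neq0 g20 p0')) => e.
  by rewrite -pE d1 gE' e !mulr0.
(* G - P is g0 - p0 + k g2 x, so the common zero of G and P has this abscissa. *)
pose x0 := (p0 - g0) / (g2 * k%:R).
pose y0 := - (g0 + g1 * x0) / g2.
have zg : g0 + g1 * x0 + g2 * y0 = 0 by rewrite /y0; field.
have zp : p0 + p1 * x0 + g2 * y0 = 0.
  by rewrite /y0 g1E /x0; field; rewrite kK0 g20.
apply: (@no_normalized_pencil K char0 k B C a1 a2 p (g0 / g2) (p0 / g2) x0 y0) => //.
- move=> a ha h; have := vert a ha; rewrite CsE -gp2 !linear_poly_monic // -!scalerAr.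
  move/(scalerI g20)/split_power_sums => /(_ h); rewrite big_map.
  have -> : (g0 + g1 * a) / g2 = g0 / g2 + (p + k%:R - 1) * a.
    by rewrite g1E /p; field.
  have -> : (p0 + p1 * a) / g2 = p0 / g2 + (p - 1) * a by rewrite /p; field.
  by [].
- move=> h; move: diag; rewrite pE gE' (linear_poly_monic _ (mulf_neq0 g20 p0'))
    (linear_poly_monic _ (mulf_neq0 g20 g0')) -!scalerAr !scalerA.
  have -> : 2 * (g2 * (p + k%:R)) = 2 ^+ k * (g2 * p) by rewrite -gE' -d1 pE.
  move/(scalerI (mulf_neq0 two_k (mulf_neq0 g20 p0')))/split_power_sums => /(_ h).
  by rewrite big_map !invfM !mulrA.
- by apply: (mulfI g20); rewrite mulr0 -[RHS]zg g1E /p; field.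
- by apply: (mulfI g20); rewrite mulr0 -[RHS]zp /p; field.
by apply: zero zg _; rewrite -gp2.
Qed.

End Pencil.

(** * Degrees of affine forms and of products; [msize] is the degree plus one *)

Section AffineSize.
Variables (K : fieldType) (n : nat).
Local Notation S := {mpoly K[n]}.

Lemma affine_eq (f : S) : (msize f <= 2)%N ->
  f = affine f@_0%MM (fun i => f@_U_(i)%MM).
Proof.
move=> sf; apply/mpolyP => m.
have [m0|m0] := posnP (mdeg m).
  have -> : m = 0%MM by apply/eqP; rewrite -mdeg_eq0 m0.
  rewrite /affine mcoeffD mcoeffC eqxx mulr1 raddf_sum /= big1 ?addr0 // => i _.
  by rewrite mcoeffZ mcoeffX mnm1_eq0 mulr0.
have [/eqP|m1] := eqVneq (mdeg m) 1%N.
  by rewrite mdeg_eq1 => /existsP[i /eqP ->]; rewrite mcoeff_affine.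
have sm : (2 <= mdeg m)%N by lia.
rewrite memN_msupp_eq0 ?msize_mdeg_ge ?(leq_trans sf) //.
rewrite /affine mcoeffD mcoeffC raddf_sum /= big1 => [|i _].
  by rewrite -mdeg_eq0 gtn_eqF // mulr0 addr0.
rewrite mcoeffZ mcoeffX; case: eqP => [mE|_]; last by rewrite mulr0.
by move: m1; rewrite -mE mdeg1 eqxx.
Qed.

Lemma msize_affine a0 a i : a i != 0 -> msize (affine a0 a : S) = 2.
Proof.
move=> ai; apply/eqP; rewrite eqn_leq; apply/andP; split; last first.
  have := @msize_mdeg_lt n K (affine a0 a) U_(i)%MM.
  by rewrite mcoeff_msupp mcoeff_affine mdeg1; apply.
rewrite (leq_trans (msizeD_le _ _)) // geq_max msizeC; apply/andP; split.
  by case: eqP.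
apply: (big_ind (fun f : S => msize f <= 2)%N); first by rewrite msize0.
  by move=> f g sf sg; rewrite (leq_trans (msizeD_le _ _)) // geq_max sf.
by move=> j _; rewrite (leq_trans (msizeZ_le _ _)) // msizeX mdeg1.
Qed.

Lemma msize_prod_linear (I : eqType) (s : seq I) (F : I -> S) :
  {in s, forall i, msize (F i) = 2} -> msize (\prod_(i <- s) F i) = (size s).+1.
Proof.
elim: s => [|i s IH] sF; first by rewrite big_nil msize1.
have sp := IH (fun j js => sF j (mem_behead (s := i :: s) js)).
rewrite big_cons msizeM -?msize_poly_eq0 ?sp ?sF ?mem_head //.
Qed.

Lemma msizeM_leq (f g : S) a b :
  (msize f <= a)%N -> (msize g <= b)%N -> (msize (f * g) <= (a + b).-1)%N.
Proof.
move=> fa gb; have [->|f0] := eqVneq f 0; first by rewrite mul0r msize0.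
have [->|g0] := eqVneq g 0; first by rewrite mulr0 msize0.
by rewrite msizeM // -!subn1 leq_sub2r // leq_add.
Qed.

(** The truncated subtraction is meant: for b <= a the bound says that g is zero. *)
Lemma msize_cofactor (f g : S) a b :
  f != 0 -> msize f = a.+1 -> (msize (f * g) <= b)%N -> (msize g <= b - a)%N.
Proof.
move=> f0 fa; have [->|g0] := eqVneq g 0; first by rewrite msize0.
by rewrite msizeM // fa /=; move: (msize g) => x; lia.
Qed.

End AffineSize.

Section Planar.
Variable K : fieldType.
Hypothesis char0 : [pchar K] =i pred0.
Local Notation A2 := {mpoly K[2]}.
Local Notation X := ('X_ord0 : A2).
Local Notation Y := ('X_ord_max : A2).

Definition plane_form (c a b : K) : A2 := affine c (fun i => if i == ord0 then a else b).

Lemma plane_formE c a b : plane_form c a b = c%:MP + (a *: X + b *: Y).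
Proof.
rewrite /plane_form /affine big_ord_recl big_ord1 /=.
by have -> : lift ord0 ord0 = ord_max :> 'I_2 by apply: val_inj.
Qed.

Lemma plane_form_eq (f : A2) : (msize f <= 2)%N ->
  f = plane_form f@_0%MM f@_U_(ord0)%MM f@_U_(ord_max)%MM.
Proof.
move=> sf; rewrite {1}(affine_eq sf) plane_formE /affine big_ord_recl big_ord1.
by have -> : lift ord0 ord0 = ord_max :> 'I_2 by apply: val_inj.
Qed.

Definition plane_subst (u v : {poly K}) : {rmorphism A2 -> {poly K}} :=
  mmap (@polyC K) (fun i : 'I_2 => if i == ord0 then u else v).

Lemma plane_substE u v c a b :
  plane_subst u v (plane_form c a b) = c%:P + (a *: u + b *: v).
Proof.
rewrite plane_formE !rmorphD -!mul_mpolyC !rmorphM /plane_subst /= !mmapC.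
by rewrite !mmapX !mmap1U /= !mul_polyC.
Qed.

Definition plane_point (x y : K) (i : 'I_2) : K := if i == ord0 then x else y.

Lemma meval_plane_form c a b x y :
  (plane_form c a b).@[plane_point x y] = c + (a * x + b * y).
Proof. by rewrite plane_formE !mevalD !mevalZ mevalC !mevalXU. Qed.

Lemma plane_form_prime c a b : (a != 0) || (b != 0) -> prime_elt (plane_form c a b).
Proof.
case/orP=> h; first exact: (@affine_prime _ _ _ _ ord0).
exact: (@affine_prime _ _ _ _ ord_max).
Qed.

Lemma plane_form_ndvd c a b c' a' b' x y :
  c + (a * x + b * y) = 0 -> c' + (a' * x + b' * y) = 1 ->
  ~ dvdr (plane_form c a b) (plane_form c' a' b').
Proof.
move=> h0 h1; apply: (not_dvdr_meval (v := plane_point x y)).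
  by rewrite meval_plane_form.
by rewrite meval_plane_form h1 oner_neq0.
Qed.

Lemma msize_plane_form c a b : (a != 0) || (b != 0) -> msize (plane_form c a b) = 2.
Proof.
case/orP=> h; first exact: (@msize_affine _ _ _ _ ord0).
exact: (@msize_affine _ _ _ _ ord_max).
Qed.

Lemma plane_form_neq0 c a b : (a != 0) || (b != 0) -> plane_form c a b != 0.
Proof. by move=> h; rewrite -msize_poly_eq0 msize_plane_form. Qed.

Local Notation vline a := (plane_form (- a) 1 0).
Local Notation hline b := (plane_form (- b) 0 1).
Local Notation dline := (plane_form 0 1 (-1)).
Local Notation aline c := (plane_form (- c) 1 1).

(** The field f d/dX + g d/dY, applied to the equation of each of the affine lines x = a, y = b, x =
    y, x + y = c, gives a multiple of that equation. *)
Definition tangent (a1 a2 : K) (B C : seq K) (f g : A2) : Prop :=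
  [/\ dvdr (vline a1) f /\ dvdr (vline a2) f,
      forall b, b \in B -> dvdr (hline b) g,
      dvdr dline (f - g) & forall c, c \in C -> dvdr (aline c) (f + g)].

Let v10 : ((1 : K) != 0) || ((0 : K) != 0). Proof. by rewrite oner_neq0. Qed.
Let v01 : ((0 : K) != 0) || ((1 : K) != 0). Proof. by rewrite oner_neq0 orbT. Qed.
Let v11 : ((1 : K) != 0) || ((1 : K) != 0). Proof. by rewrite oner_neq0. Qed.
Let v1N : ((1 : K) != 0) || ((-1 : K) != 0). Proof. by rewrite oner_neq0. Qed.

Lemma tangent_factor a1 a2 B C f g : uniq B -> uniq C -> tangent a1 a2 B C f g ->
  exists G P, g = (\prod_(b <- B) hline b) * G /\ f + g = (\prod_(c <- C) aline c) * P.
Proof.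
move=> uB uC [_ tB _ tC].
have [G GE] : dvdr (\prod_(b <- B) hline b) g.
  apply: prod_primes_dvdr => // [b _|b b' _ _ neq]; first exact: plane_form_prime.
  apply: (not_dvdr_meval (v := plane_point 0 b)); rewrite meval_plane_form.
    by ring.
  by rewrite mul0r mul1r add0r addrC subr_eq0.
have [P PE] : dvdr (\prod_(c <- C) aline c) (f + g).
  apply: prod_primes_dvdr => // [c _|c c' _ _ neq]; first exact: plane_form_prime.
  apply: (not_dvdr_meval (v := plane_point 0 c)); rewrite meval_plane_form.
    by ring.
  by rewrite mulr0 mul1r add0r addrC subr_eq0.
by exists G, P.
Qed.

Lemma no_tangent_pair k a1 a2 B C f2 g2 f3 g3 d2 d3 :
  (4 <= k)%N -> size B = k -> size C = k -> uniq B -> uniq C -> a1 != a2 ->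
  tangent a1 a2 B C f2 g2 -> tangent a1 a2 B C f3 g3 ->
  (d2 + d3 <= 2 * k + 3)%N ->
  (msize f2 <= d2.+1)%N -> (msize g2 <= d2.+1)%N ->
  (msize f3 <= d3.+1)%N -> (msize g3 <= d3.+1)%N ->
  f2 * g3 - f3 * g2 = 0.
Proof.
wlog d23 : f2 g2 f3 g3 d2 d3 / (d2 <= d3)%N => [h|].
  have [le23|/ltnW le32] := leqP d2 d3; first exact: h.
  move=> k4 sB sC uB uC na t2 t3 d sf2 sg2 sf3 sg3.
  apply/eqP; rewrite -oppr_eq0 opprB; apply/eqP; rewrite addnC in d.
  exact: h le32 k4 sB sC uB uC na t3 t2 d sf3 sg3 sf2 sg2.
move=> k4 sB sC uB uC na t2 t3 d sf2 sg2 sf3 sg3; apply/eqP/negPn/negP => det0.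
have [G2 [P2 [g2E p2E]]] := tangent_factor uB uC t2.
have [G3 [P3 [g3E p3E]]] := tangent_factor uB uC t3.
set BB := \prod_(b <- B) hline b in g2E g3E.
set CC := \prod_(c <- C) aline c in p2E p3E.
have sBB : msize BB = k.+1 by rewrite msize_prod_linear ?sB // => b _; apply: msize_plane_form.
have sCC : msize CC = k.+1 by rewrite msize_prod_linear ?sC // => c _; apply: msize_plane_form.
have BB0 : BB != 0 by rewrite -msize_poly_eq0 sBB.
have CC0 : CC != 0 by rewrite -msize_poly_eq0 sCC.
have sG2 : (msize G2 <= d2.+1 - k)%N by apply: (msize_cofactor BB0 sBB); rewrite -g2E.
have sG3 : (msize G3 <= d3.+1 - k)%N by apply: (msize_cofactor BB0 sBB); rewrite -g3E.
have sP2 : (msize P2 <= d2.+1 - k)%N.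
  apply: (msize_cofactor CC0 sCC); rewrite -p2E.
  by rewrite (leq_trans (msizeD_le _ _)) // geq_max sf2.
have sP3 : (msize P3 <= d3.+1 - k)%N.
  apply: (msize_cofactor CC0 sCC); rewrite -p3E.
  by rewrite (leq_trans (msizeD_le _ _)) // geq_max sf3.
pose D := P2 * G3 - P3 * G2.
have detE : f2 * g3 - f3 * g2 = BB * CC * D.
  have -> : f2 * g3 - f3 * g2 = (f2 + g2) * g3 - (f3 + g3) * g2 by ring.
  by rewrite p2E p3E g2E g3E /D; ring.
have D0 : D != 0 by apply: contraNneq det0 => D0; rewrite detE D0 mulr0.
(* If d2 < k, the truncated bounds make G2 and P2 zero. Otherwise the subtractions are exact and the
   degree count below is valid. *)
have d2k : (k <= d2)%N.
  rewrite leqNgt; apply: contraNN D0 => dk.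
  have e : (d2.+1 - k = 0)%N by apply/eqP; rewrite subn_eq0.
  rewrite e !leqn0 !msize_poly_eq0 in sG2 sP2.
  by rewrite /D (eqP sG2) (eqP sP2) mul0r mulr0 subrr.
have sD : (msize D <= 4)%N.
  have s1 := msizeM_leq sP2 sG3; have s2 := msizeM_leq sP3 sG2.
  have e : ((d2.+1 - k + (d3.+1 - k)).-1 <= 4)%N by clear -d2k d23 d; lia.
  rewrite (leq_trans (msizeD_le _ _)) // msizeN geq_max (leq_trans s1) //.
  by rewrite (leq_trans s2) // addnC.
have two0 : 2 != 0 :> K := natr_neq0_char0 char0 (isT : 0 < 2)%N.
have v_ndvd a : ~ dvdr (vline a) (BB * CC).
  have prV : prime_elt (vline a) by exact: plane_form_prime.
  case/prV.2 => /(prime_elt_prod prV)[z _].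
    by apply: (plane_form_ndvd (x := a) (y := (z + 1))); ring.
  by apply: (plane_form_ndvd (x := a) (y := (z - a + 1))); ring.
have d_ndvd : ~ dvdr dline (BB * CC).
  have prV : prime_elt dline by exact: plane_form_prime.
  case/prV.2 => /(prime_elt_prod prV)[z _].
    by apply: (plane_form_ndvd (x := (z + 1)) (y := (z + 1))); ring.
  by apply: (plane_form_ndvd (x := ((z + 1) / 2)) (y := ((z + 1) / 2))); field.
have [[v12 v22] tB2 tD2 tC2] := t2; have [[v13 v23] tB3 tD3 tC3] := t3.
have vD a : dvdr (vline a) f2 -> dvdr (vline a) f3 -> dvdr (vline a) D.
  move=> va2 va3; have prV : prime_elt (vline a) by exact: plane_form_prime.
  have : dvdr (vline a) (BB * CC * D) by rewrite -detE; apply: dvdrB; apply: dvdrMl.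
  by case/prV.2 => // /v_ndvd.
have dD : dvdr dline D.
  have prV : prime_elt dline by exact: plane_form_prime.
  have : dvdr dline (BB * CC * D).
    rewrite -detE (_ : _ - _ = (f2 - g2) * g3 - (f3 - g3) * g2); last by ring.
    by apply: dvdrB; apply: dvdrMl.
  by case/prV.2 => // /d_ndvd.
have [D1 D1E] := vD a1 v12 v13.
have [D2 D2E] : dvdr (vline a2) D1.
  have prV : prime_elt (vline a2) by exact: plane_form_prime.
  have := vD a2 v22 v23; rewrite D1E => /prV.2[] // h; exfalso; move: h.
  apply: (not_dvdr_meval (v := plane_point a2 0)); rewrite meval_plane_form; first by ring.
  by rewrite mul1r mulr0 addr0 addrC subr_eq0 eq_sym.
have [D3 D3E] : dvdr dline D2.
  have prV : prime_elt dline by exact: plane_form_prime.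
  have nv a : ~ dvdr dline (vline a).
    by apply: (plane_form_ndvd (x := (a + 1)) (y := (a + 1))); ring.
  by have := dD; rewrite D1E D2E => /prV.2[/nv|/prV.2[/nv|]].
(* Here d2 <= d3 and d2 + d3 <= 2k + 3 give d2 <= k + 1. *)
have sG2' : (msize G2 <= 2)%N by apply: leq_trans sG2 _; clear -d d23; lia.
have sP2' : (msize P2 <= 2)%N by apply: leq_trans sP2 _; clear -d d23; lia.
have D30 : D3 != 0.
  by apply: contraNneq D0 => D30; rewrite D1E D2E D3E D30 !mulr0.
have [e e0 D3c] : exists2 e, e != 0 & D3 = e%:MP.
  apply/msize_poly1P; move: sD; rewrite D1E D2E D3E.
  have nz a b c := @plane_form_neq0 a b c.
  do 3! [rewrite msizeM ?mulf_neq0 ?nz // msize_plane_form //=].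
  by move: D30; rewrite -msize_poly_eq0; move: (msize D3) => x; clear; lia.
pose g0 := G2@_0%MM; pose gx := G2@_U_(ord0)%MM; pose gy := G2@_U_(ord_max)%MM.
pose p0 := P2@_0%MM; pose px := P2@_U_(ord0)%MM; pose py := P2@_U_(ord_max)%MM.
have G2E : G2 = plane_form g0 gx gy by exact: plane_form_eq.
have P2E : P2 = plane_form p0 px py by exact: plane_form_eq.
have [[g00 [gx0 gy0]] [p00 [px0 py0]]] :
    (g0 = 0 /\ gx = 0 /\ gy = 0) /\ (p0 = 0 /\ px = 0 /\ py = 0).
  (* On x = a the component f vanishes, and on the diagonal f = g; so the factorizations of g and f
     + g become identities between polynomials in one variable. *)
  apply: (no_common_pencil char0 k4 sB sC na).
  - move=> a ha; pose ev := plane_subst a%:P 'X.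
    have va : dvdr (vline a) f2 by case: ha => ->.
    have f20 : ev f2 = 0.
      have [w ->] := va; rewrite rmorphM plane_substE scale0r addr0 scale1r.
      by rewrite polyCN addNr mul0r.
    have := congr1 ev p2E; rewrite rmorphD f20 add0r g2E !rmorphM !rmorph_prod.
    rewrite G2E P2E !plane_substE.
    have -> : \prod_(b <- B) ev (hline b) = \prod_(b <- B) ('X - b%:P).
      by apply: eq_bigr => b _; rewrite plane_substE scale0r add0r scale1r polyCN addrC.
    have -> : \prod_(c <- C) ev (aline c) = \prod_(c <- C) ('X - (c - a)%:P).
      apply: eq_bigr => c _; rewrite plane_substE !scale1r polyCB polyCN opprB.
      by rewrite addrA addrC [- _ + _]addrC.
    by rewrite !polyCD !polyCM !mul_polyC !addrA.
  - pose ev := plane_subst 'X 'X.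
    have fg : ev f2 = ev g2.
      apply/eqP; rewrite -subr_eq0 -rmorphB; have [w ->] := tD2.
      by rewrite rmorphM plane_substE polyC0 add0r scale1r scaleN1r subrr mul0r.
    have := congr1 ev p2E; rewrite rmorphD fg g2E !rmorphM !rmorph_prod.
    rewrite G2E P2E !plane_substE.
    have -> : \prod_(b <- B) ev (hline b) = \prod_(b <- B) ('X - b%:P).
      by apply: eq_bigr => b _; rewrite plane_substE scale0r add0r scale1r polyCN addrC.
    have -> : \prod_(c <- C) ev (aline c) = \prod_(c <- C) (2 *: 'X - c%:P).
      apply: eq_bigr => c _; rewrite plane_substE !scale1r polyCN addrC.
      by rewrite scaler_nat mulr2n.
    by rewrite -!scalerDl => <-; rewrite scaler_nat mulr2n.
  move=> x y zg zp; have : D.@[plane_point x y] = 0.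
    rewrite /D G2E P2E mevalB !mevalM !meval_plane_form !addrA zg zp.
    by rewrite mul0r mulr0 subrr.
  rewrite D1E D2E D3E D3c !mevalM !meval_plane_form mevalC => /eqP.
  rewrite !mulf_eq0 (negPf e0) orbF => /or3P[] /eqP h.
  - by apply: Or31; apply: (eq_multiple (c := 1) h); ring.
  - by apply: Or32; apply: (eq_multiple (c := 1) h); ring.
  by apply: Or33; apply: (eq_multiple (c := 1) h); ring.
move: D0; rewrite /D G2E P2E g00 gx0 gy0 p00 px0 py0.
by rewrite plane_formE mpolyC0 !scale0r !addr0 mul0r mulr0 subrr eqxx.
Qed.

End Planar.

(** * Expansion at a point *)

(* In the Leibniz formula, pair each permutation with its product by the
   transposition of the two rows. *)
Lemma det_minors_dvdr (R : comNzRingType) l (A : 'M[R]_l) (i0 i1 i2 : 'I_l) d1 d2 :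
  i0 != i1 -> i2 != i0 -> i2 != i1 ->
  (forall j j', dvdr d1 (A i0 j * A i1 j' - A i0 j' * A i1 j)) ->
  (forall j, dvdr d2 (A i2 j)) -> dvdr (d1 * d2) (\det A).
Proof.
move=> n01 n20 n21 h1 h2; pose t := tperm i0 i1.
have oddMt s: (t * s)%g = ~~ s :> bool by rewrite odd_permM odd_tperm n01.
rewrite [\det A](bigID (@odd_perm _)) /= addrC.
rewrite [X in _ + X](reindex_inj (mulgI t)) /=.
rewrite [X in _ + X](eq_bigl (fun s : 'S_l => ~~ odd_perm s)); last first.
  by move=> s; rewrite oddMt.
rewrite -big_split /=; apply: dvdr_sum => s /negPf sE.
rewrite oddMt sE mul1r /= mulN1r.
rewrite (bigD1 i0) //= (bigD1 i1) 1?eq_sym //= (bigD1 i2) ?n20 //=.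
rewrite [X in _ - X](bigD1 i0) //= [X in _ - _ * X](bigD1 i1) 1?eq_sym //=.
rewrite [X in _ - _ * (_ * X)](bigD1 i2) ?n20 //=.
rewrite !permM tpermL tpermR tpermD 1?eq_sym //.
rewrite [X in _ - _ * (_ * (_ * X))](eq_bigr (fun i => A i (s i))); last first.
  by move=> i /andP[/andP[ni0 ni1] _]; rewrite permM tpermD // eq_sym.
set r := \prod_(i < l | _) _.
rewrite !mulrA -!mulrBl; apply: dvdrMl; apply: dvdrM; last exact: h2.
exact: h1.
Qed.

(** Writing F = L (1 0) U with L and U invertible, the matrix diag(L, 1) U is invertible and starts
    with the rows of F. The embedding [f] of indices spares a cast along l = r + m. *)
Lemma complete_row_free (K : fieldType) r l (F : 'M[K]_(r, l)) : row_free F ->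
  exists (G : 'M[K]_l) (f : 'I_r -> 'I_l),
    [/\ G \in unitmx, forall i, val (f i) = val i & forall i, row (f i) G = row i F].
Proof.
move=> freeF; have rF : \rank F = r by exact/eqP.
have rl : (r <= l)%N by rewrite -rF rank_leq_col.
have lE : l = (r + (l - r))%N by rewrite subnKC.
move: (l - r)%N lE => m lE; subst l; clear rl.
pose L := col_ebase F; pose U := row_ebase F.
have FE : F = L *m row_mx 1%:M 0 *m U.
  by rewrite -{1}(mulmx_ebase F) rF pid_mx_row.
pose G := block_mx L 0 0 1%:M *m U : 'M[K]_(r + m).
exists G, (lshift m); split=> [|i|i] //.
  rewrite unitmx_mul row_ebase_unit andbT unitmxE det_lblock det1 mulr1 -unitmxE.
  exact: col_ebase_unit.
have -> : G = col_mx F (row_mx 0 1%:M *m U).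
  rewrite /G /block_mx mul_col_mx; congr col_mx.
  by rewrite [in RHS]FE mul_mx_row mulmx1 mulmx0.
by apply/rowP => j; rewrite !mxE; case: splitP => [k /= /val_inj <-|k /= e] //;
  have := ltn_ord i; rewrite e ltnNge leq_addr.
Qed.

Section FormValue.
Variables (K : fieldType) (l : nat).
Local Notation S := {mpoly K[l]}.

Lemma proportional_forms (a b : linform K l) : (lker a <= lker b)%VS ->
  exists c : K, b = c *: a.
Proof.
move=> ab; have [a0|a0] := eqVneq a 0.
  exists 0; rewrite scale0r; apply/lfunP => v; rewrite lfunE /=; apply/eqP.
  by rewrite -memv_ker (subvP ab) // memv_ker a0 lfunE.
have [v av] : exists v, a v != 0.
  have [i ai] := form_coef_neq0 a0; by exists (delta_mx 0 i).
exists (b v / a v); apply/lfunP => w; rewrite lfunE /=.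
have : w - (a w / a v) *: v \in lker a.
  by rewrite memv_ker linearB linearZ /= [_ *: _]divfK // subrr.
move/(subvP ab); rewrite memv_ker linearB linearZ /= subr_eq0 => /eqP ->.
change (a w / a v * b v = b v / a v * a w :> K).
by rewrite [LHS]mulrAC -[LHS]mulrA [LHS]mulrC.
Qed.

Definition form_value (v : 'rV[S]_l) (a : linform K l) : S :=
  \sum_j v 0 j * (form_coef a j)%:MP.

Lemma form_valueD v a b : form_value v (a + b) = form_value v a + form_value v b.
Proof.
rewrite /form_value -big_split /=; apply: eq_bigr => j _.
by rewrite /form_coef lfunE mpolyCD mulrDr.
Qed.

Lemma form_valueZ v c a : form_value v (c *: a) = c%:MP * form_value v a.
Proof.
rewrite /form_value mulr_sumr; apply: eq_bigr => j _.
by rewrite /form_coef lfunE mulrCA -mpolyCM.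
Qed.

Lemma poly_of_formZ c (a : linform K l) :
  poly_of_form (c *: a) = c%:MP * poly_of_form a.
Proof.
rewrite /poly_of_form mulr_sumr; apply: eq_bigr => i _.
by rewrite lfunE mul_mpolyC scalerA.
Qed.

(** [alpha] picks an arbitrary form for each hyperplane; divisibility passes to every proportional
    form, such as x - a z. *)
Lemma log_row_form (E : arrangement K l) v (w : linform K l) :
  is_arrangement E -> log_row E v -> lker w \in E ->
  dvdr (poly_of_form w) (form_value v w).
Proof.
move=> arrE lv wE; have := lv _ wE.
have [c wc] : exists c, w = c *: alpha (lker w).
  by apply: proportional_forms; rewrite lker_alpha ?arrE.
rewrite -/(form_value v _); set a := alpha _ in wc * => h.
rewrite wc form_valueZ poly_of_formZ; apply: dvdrM => //; exact: dvdr_refl.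
Qed.

End FormValue.

Lemma coef0_addXM (R : comNzRingType) (c : R) q : (c%:P + 'X * q)`_0 = c.
Proof. by rewrite coefD coefXM coefC addr0. Qed.

Section Localization.
Variables (K : fieldType) (l : nat).
Variables (p ex ey ez : 'rV[K]_l).
Local Notation S := {mpoly K[l]}.
Local Notation A2 := {mpoly K[2]}.
Local Notation X := ('X_ord0 : A2).
Local Notation Y := ('X_ord_max : A2).

(* Substitution of the point [p + t (X ex + Y ey + ez)], as a polynomial in [t]
   over K[X, Y]; the powers of [t] play the role of the grading of the
   localization at [p]. *)
Variable expand : {rmorphism S -> {poly A2}}.
Hypothesis expandC : forall c, expand c%:MP = c%:MP%:P.
Hypothesis expandX : forall j, expand 'X_j =
  (p 0 j)%:MP%:P + 'X * (plane_form (ez 0 j) (ex 0 j) (ey 0 j))%:P.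

Lemma sum_plane_form (c u v w : 'I_l -> K) :
  \sum_j (c j)%:MP * plane_form (u j) (v j) (w j) =
  plane_form (\sum_j c j * u j) (\sum_j c j * v j) (\sum_j c j * w j).
Proof.
rewrite plane_formE raddf_sum /= !scaler_suml -!big_split /=.
apply: eq_bigr => j _; rewrite plane_formE !mulrDr -mpolyCM.
by rewrite !mul_mpolyC !scalerA.
Qed.

Lemma expand_form (a : linform K l) : expand (poly_of_form a) =
  (a p)%:MP%:P + 'X * (plane_form (a ez) (a ex) (a ey))%:P.
Proof.
have -> : plane_form (a ez) (a ex) (a ey) =
    \sum_j (form_coef a j)%:MP * plane_form (ez 0 j) (ex 0 j) (ey 0 j).
  by rewrite sum_plane_form; congr plane_form; apply: linform_sum.
have -> : (a p)%:MP = \sum_j (form_coef a j)%:MP * (p 0 j)%:MP :> A2.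
  under eq_bigr do rewrite -mpolyCM.
  by rewrite -raddf_sum; congr (_%:MP); apply: linform_sum.
rewrite !raddf_sum /= mulr_sumr -big_split /=; apply: eq_bigr => j _.
rewrite -mul_mpolyC rmorphM /= expandC expandX.
by rewrite mulrDr !rmorphM /= mulrCA.
Qed.

(** In the substitution each t is accompanied by one factor that is affine in X and Y, so the
    coefficient of t^d has degree at most d. *)
Lemma msize_expand f d : (msize (expand f)`_d <= d.+1)%N.
Proof.
elim/mpoly_ring_ind: f d => [c|j|f g hf hg|f g hf hg] d.
- by rewrite expandC coefC; case: eqP => _; rewrite ?msize0 // msizeC; case: eqP.
- rewrite expandX coefD coefC coefXM coefC.
  case: d => [|[|d]] /=; rewrite ?addr0 ?add0r ?msize0 // ?msizeC; first by case: eqP.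
  rewrite plane_formE (leq_trans (msizeD_le _ _)) // geq_max msizeC; apply/andP; split.
    by case: eqP.
  by rewrite (leq_trans (msizeD_le _ _)) // geq_max !(leq_trans (msizeZ_le _ _)) // msizeX mdeg1.
- by rewrite rmorphD coefD (leq_trans (msizeD_le _ _)) // geq_max hf hg.
rewrite rmorphM coefM; apply: (big_ind (fun q : A2 => msize q <= d.+1)%N).
- by rewrite msize0.
- by move=> q r sq sr; rewrite (leq_trans (msizeD_le _ _)) // geq_max sq.
move=> i _; rewrite (leq_trans (msizeM_leq (hf _) (hg _))) //.
by have := ltn_ord i; lia.
Qed.

(** A hyperplane through p contributes t times a nonzero plane form, any other one a series with
    nonzero constant term. So Q(E) vanishes at p to the order given by the count. *)
Lemma expand_arrangement (E : arrangement K l) :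
  (forall H, H \in E -> p \in H -> exists a b c,
     [/\ alpha H ex = a, alpha H ey = b, alpha H ez = c & [|| a != 0, b != 0 | c != 0]]) ->
  is_arrangement E ->
  exists w : {poly A2}, w`_0 != 0 /\
    expand (\prod_(H <- E) poly_of_form (alpha H)) =
    'X^(count (fun H : subspace K l => p \in H) E) * w.
Proof.
move=> hp arrE; have : {subset (E : seq _) <= E} by [].
elim: (E : seq _) => [|H s IH] sub.
  by exists 1; rewrite big_nil rmorph1 mulr1 coefC oner_neq0.
have HE : H \in E by apply: sub; apply: mem_head.
have [|w [w0 wE]] := IH; first by move=> H' sH'; apply: sub; rewrite inE sH' orbT.
rewrite big_cons rmorphM wE /=; have [pH|pH] := boolP (p \in H).
  exists ((plane_form (alpha H ez) (alpha H ex) (alpha H ey))%:P * w); split.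
    rewrite coefCM mulf_neq0 //.
    have [a [b [c [-> -> ->]]]] := hp H HE pH; rewrite orbA.
    have [/plane_form_neq0 -> //|ab /= c0] := boolP ((a != 0) || (b != 0)).
    apply/eqP => /(congr1 (meval (plane_point 0 0))) /eqP.
    by rewrite meval_plane_form !mulr0 !addr0 meval0 (negPf c0).
  rewrite expand_form; have /eqP -> : alpha H p == 0 by rewrite hyperplane_vanish ?arrE.
  by rewrite mpolyC0 polyC0 add0r exprS -!mulrA; congr (_ * _); rewrite mulrCA.
exists (expand (poly_of_form (alpha H)) * w); rewrite add0n; split; last exact: mulrCA.
rewrite coefM big_ord1 subnn; apply: mulf_neq0; last exact: w0.
rewrite expand_form coef0_addXM.
by rewrite mpolyC_eq0 hyperplane_vanish ?arrE.
Qed.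

End Localization.

Lemma dvdr_polyXn (R : comNzRingType) (f : {poly R}) N :
  (forall m, (m < N)%N -> f`_m = 0) -> dvdr 'X^N f.
Proof.
move=> f0; exists (drop_poly N f); rewrite -[LHS](poly_take_drop N) mulrC.
rewrite (_ : take_poly N f = 0) ?add0r //; apply/polyP => m.
by rewrite coef_take_poly coef0; case: ifP => // /f0.
Qed.

(** On the substituted point x, y, z are tX, tY, t, so subtracting s times the Euler field replaces
    fx, fy, fz by fx - X fz, fy - Y fz, 0. The Euler field reproduces every linear form, which keeps
    the divisibility. *)
Lemma subtract_euler (R : comNzRingType) (t a b c x y fx fy fz q s : R) :
  a * fx + b * fy + c * fz = t * (c + a * x + b * y) * q -> fz = t * s ->
  a * (fx - x * fz) + b * (fy - y * fz) = t * (c + a * x + b * y) * (q - s).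
Proof.
by move=> e fzE; rewrite [RHS]mulrBr -e fzE; ring.
Qed.

Lemma plane_form1 (K : fieldType) : plane_form 1 0 0 = 1 :> {mpoly K[2]}.
Proof. by rewrite plane_formE !scale0r !addr0. Qed.

Section LocalFields.
Variables (K : fieldType) (l : nat).
Variables (E : arrangement K l) (x y z : linform K l) (p ex ey ez : 'rV[K]_l).
Local Notation S := {mpoly K[l]}.
Local Notation A2 := {mpoly K[2]}.
Local Notation X := ('X_ord0 : A2).
Local Notation Y := ('X_ord_max : A2).

Hypothesis arrE : is_arrangement E.
Variable expand : {rmorphism S -> {poly A2}}.
Hypothesis expandC : forall c, expand c%:MP = c%:MP%:P.
Hypothesis expandX : forall j, expand 'X_j =
  (p 0 j)%:MP%:P + 'X * (plane_form (ez 0 j) (ex 0 j) (ey 0 j))%:P.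
Hypotheses (xp : x p = 0) (yp : y p = 0) (zp : z p = 0).
Hypotheses (xex : x ex = 1) (xey : x ey = 0) (xez : x ez = 0).
Hypotheses (yex : y ex = 0) (yey : y ey = 1) (yez : y ez = 0).
Hypotheses (zex : z ex = 0) (zey : z ey = 0) (zez : z ez = 1).

Lemma expand_log_row (v : 'rV[S]_l) a b c : log_row E v ->
  lker (a *: x + b *: y + c *: z) \in E -> lker z \in E ->
  dvdr ('X * (plane_form c a b)%:P)
    (a%:MP%:P * (expand (form_value v x) - X%:P * expand (form_value v z))
     + b%:MP%:P * (expand (form_value v y) - Y%:P * expand (form_value v z))).
Proof.
move=> lv wE zE; have [q qE] := log_row_form arrE lv wE.
have [s sE] := log_row_form arrE lv zE.
have wE' t : (a *: x + b *: y + c *: z) t = a * x t + b * y t + c * z t :> K.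
  by rewrite !add_lfunE !scale_lfunE.
have eW : expand (poly_of_form (a *: x + b *: y + c *: z)) = 'X * (plane_form c a b)%:P.
  rewrite (expand_form expandC expandX) !wE' xp yp zp xex xey xez yex yey yez zex zey zez.
  by rewrite !mulr0 !mulr1 !addr0 ?add0r.
have eZ : expand (poly_of_form z) = 'X.
  rewrite (expand_form expandC expandX) zp zex zey zez mpolyC0 polyC0 add0r.
  by rewrite plane_form1 polyC1 mulr1.
have qE' := congr1 expand qE; have sE' := congr1 expand sE.
rewrite [in RHS]rmorphM /= eW in qE'.
rewrite !(form_valueD, form_valueZ) 2!rmorphD 3!rmorphM /= !expandC in qE'.
rewrite rmorphM /= eZ in sE'.
have PE : (plane_form c a b)%:P = c%:MP%:P + a%:MP%:P * X%:P + b%:MP%:P * Y%:P.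
  by rewrite plane_formE -!mul_mpolyC !rmorphD !rmorphM /= addrA.
exists (expand q - expand s); rewrite PE in qE' *.
exact: subtract_euler.
Qed.

Variables (a1 a2 : K) (B C : seq K).
Hypotheses (B0 : B != [::]) (zE : lker z \in E).
Hypothesis linesE : [/\ lker (x - a1 *: z) \in E /\ lker (x - a2 *: z) \in E,
  forall b, b \in B -> lker (y - b *: z) \in E, lker (x - y) \in E &
  forall c, c \in C -> lker (x + y - c *: z) \in E].

Lemma expand_tangent (v : 'rV[S]_l) : log_row E v ->
  exists f g s : {poly A2},
    [/\ expand (form_value v x) - X%:P * expand (form_value v z) = 'X * f,
        expand (form_value v y) - Y%:P * expand (form_value v z) = 'X * g,
        expand (form_value v z) = 'X * s &
        forall d, tangent a1 a2 B C f`_d g`_d /\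
          (msize f`_d <= d.+2 /\ msize g`_d <= d.+2)%N].
Proof.
move=> lv; have [[va1 va2] hB dE aC] := linesE.
set Fx := expand _ - _; set Fy := expand (form_value v y) - _.
have V a : lker (x - a *: z) \in E -> dvdr ('X * (plane_form (- a) 1 0)%:P) Fx.
  move=> aE; have := @expand_log_row v 1 0 (- a) lv; rewrite scale1r scale0r addr0 scaleNr.
  by move=> /(_ aE zE); rewrite mpolyC1 polyC1 mul1r mpolyC0 polyC0 mul0r addr0.
have Hl b : lker (y - b *: z) \in E -> dvdr ('X * (plane_form (- b) 0 1)%:P) Fy.
  move=> bE; have := @expand_log_row v 0 1 (- b) lv; rewrite scale1r scale0r add0r scaleNr.
  by move=> /(_ bE zE); rewrite mpolyC1 polyC1 mul1r mpolyC0 polyC0 mul0r add0r.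
have Dl : dvdr ('X * (plane_form 0 1 (-1))%:P) (Fx - Fy).
  have := @expand_log_row v 1 (-1) 0 lv; rewrite scale1r scale0r addr0 scaleN1r.
  by move=> /(_ dE zE); rewrite mpolyC1 polyC1 mul1r mpolyCN mpolyC1 polyCN polyC1 mulN1r.
have Al c : c \in C -> dvdr ('X * (plane_form (- c) 1 1)%:P) (Fx + Fy).
  move=> cC; have := @expand_log_row v 1 1 (- c) lv; rewrite !scale1r scaleNr.
  by move=> /(_ (aC c cC) zE); rewrite mpolyC1 polyC1 [X in X + _]mul1r [X in _ + X]mul1r.
have [f fE] : dvdr 'X Fx by have [q ->] := V a1 va1; rewrite -mulrA; apply: dvdrMl; apply: dvdr_refl.
have [g gE] : dvdr 'X Fy.
  case: B B0 hB => // b s _ /(_ b (mem_head _ _)) /Hl [q ->].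
  by rewrite -mulrA; apply: dvdrMl; apply: dvdr_refl.
have [s sE] : exists s, expand (form_value v z) = 'X * expand s.
  have [s sE] := log_row_form arrE lv zE.
  exists s; rewrite sE rmorphM /= (expand_form expandC expandX) zp zex zey zez.
  by rewrite mpolyC0 polyC0 add0r plane_form1 polyC1 mulr1.
exists f, g, (expand s); split=> // d.
have X0 : ('X : {poly A2}) != 0 by rewrite polyX_eq0.
have coef_dvdr (P : A2) h : dvdr ('X * P%:P) ('X * h) -> dvdr P h`_d.
  by case=> q; rewrite -mulrA => /(mulfI X0) ->; exists (q`_d); rewrite coefCM.
(* Dividing by t shifts indices: the coefficient of t^d in the quotient comes from index d + 1 of F
   and from w times index d of s. Both have degree at most d + 1, that is, [msize] at most d + 2. *)
have size_dvdr (w : A2) F h : msize w = 2 ->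
    expand F - w%:P * expand (form_value v z) = 'X * h -> (msize h`_d <= d.+2)%N.
  move=> w2 hE; have -> : h`_d = (expand F)`_d.+1 - w * (expand s)`_d.
    by have := congr1 (fun q : {poly A2} => q`_d.+1) hE; rewrite coefB coefCM coefXM sE coefXM /= => ->.
  rewrite (leq_trans (msizeD_le _ _)) // msizeN geq_max (msize_expand expandC expandX) /=.
  have := msizeM_leq (eq_leq w2) (msize_expand expandC expandX s d).
  by rewrite addSn add1n.
split; last by rewrite (size_dvdr X (form_value v x)) ?(size_dvdr Y (form_value v y)) // msizeX mdeg1.
rewrite fE gE in V Hl Dl Al *; split.
- by split; apply: coef_dvdr; apply: V.
- by move=> b bB; apply: coef_dvdr; apply/Hl/hB.
- by rewrite -coefB; apply: coef_dvdr; rewrite mulrBr.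
by move=> c cC; rewrite -coefD; apply: coef_dvdr; rewrite mulrDr; apply: Al.
Qed.
End LocalFields.

Lemma ord3_cases (i : 'I_3) : [\/ i = inord 0, i = inord 1 | i = inord 2].
Proof.
by case: i => [[|[|[|]]]] // h; [apply: Or31 | apply: Or32 | apply: Or33];
  apply: val_inj; rewrite /= inordK.
Qed.

(** The default value of [nth] supplies the row of index 2, so the rows of F are x, y, z. The
    columns of a right inverse of F are the dual points. *)
Lemma dual_points (K : fieldType) l (x y z : linform K l) :
  (forall a b c : K, a *: x + b *: y + c *: z = 0 -> [/\ a = 0, b = 0 & c = 0]) ->
  let F := \matrix_(i < 3, j < l) form_coef (nth z [:: x; y] i) j in
  row_free F /\ exists ex ey ez : 'rV[K]_l,
    [/\ [/\ x ex = 1, x ey = 0 & x ez = 0], [/\ y ex = 0, y ey = 1 & y ez = 0] &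
        [/\ z ex = 0, z ey = 0 & z ez = 1]].
Proof.
move=> indep F.
have freeF : row_free F.
  apply: inj_row_free => v vF.
  have : v 0 (inord 0) *: x + v 0 (inord 1) *: y + v 0 (inord 2) *: z = 0.
    apply/lfunP => u; rewrite !add_lfunE !scale_lfunE lfunE /=.
    have := congr1 (fun A : 'rV_l => \sum_j A 0 j * u 0 j) vF.
    rewrite [RHS]big1 => [|j _]; last by rewrite mxE mul0r.
    move=> <-; under [RHS]eq_bigr do rewrite mxE mulr_suml.
    rewrite exchange_big /= !big_ord_recl big_ord0 addr0 !linform_sum.
    have e0 : ord0 = inord 0 :> 'I_3 by apply: val_inj; rewrite /= inordK.
    have e1 : lift ord0 ord0 = inord 1 :> 'I_3 by apply: val_inj; rewrite /= inordK.
    have e2 : lift ord0 (lift ord0 ord0) = inord 2 :> 'I_3.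
      by apply: val_inj; rewrite /= inordK.
    rewrite e1 e2 e0 -addrA.
    by congr (_ + (_ + _)); rewrite [LHS]mulr_sumr; apply: eq_bigr => j _;
      rewrite mxE inordK //= mulrA.
  case/indep => v0 v1 v2; apply/rowP => i; rewrite mxE.
  by case: (ord3_cases i) => ->.
split=> //; have [N FN] := row_freeP freeF.
have val (w : linform K l) i j : w = nth z [:: x; y] (i : 'I_3) ->
    w (col j N)^T = (i == j)%:R :> K.
  move=> wE; have := congr1 (fun A : 'M_3 => A i j) FN; rewrite !mxE => <-.
  by rewrite linform_sum; apply: eq_bigr => t _; rewrite !mxE wE.
exists (col (inord 0) N)^T, (col (inord 1) N)^T, (col (inord 2) N)^T.
have n (i j : nat) : (i < 3)%N -> (j < 3)%N -> (inord i == inord j :> 'I_3) = (i == j).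
  by move=> hi hj; rewrite -val_eqE /= !inordK.
split; split.
- by rewrite (val x (inord 0)) ?inordK // n.
- by rewrite (val x (inord 0)) ?inordK // n.
- by rewrite (val x (inord 0)) ?inordK // n.
- by rewrite (val y (inord 1)) ?inordK // n.
- by rewrite (val y (inord 1)) ?inordK // n.
- by rewrite (val y (inord 1)) ?inordK // n.
- by rewrite (val z (inord 2)) ?inordK // n.
- by rewrite (val z (inord 2)) ?inordK // n.
- by rewrite (val z (inord 2)) ?inordK // n.
Qed.

Theorem not_free_of_localization (K : fieldType) l (char0 : [pchar K] =i pred0)
    (E : arrangement K l) (x y z : linform K l) (p : 'rV[K]_l)
    k (a1 a2 : K) (B C : seq K) :
  is_arrangement E -> (4 <= k)%N -> size B = k -> size C = k -> uniq B -> uniq C ->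
  a1 != a2 ->
  (forall a b c : K, a *: x + b *: y + c *: z = 0 -> [/\ a = 0, b = 0 & c = 0]) ->
  x p = 0 -> y p = 0 -> z p = 0 -> lker z \in E ->
  [/\ lker (x - a1 *: z) \in E /\ lker (x - a2 *: z) \in E,
    forall b, b \in B -> lker (y - b *: z) \in E, lker (x - y) \in E &
    forall c, c \in C -> lker (x + y - c *: z) \in E] ->
  (forall H, H \in E -> p \in H -> exists a b c : K, alpha H = a *: x + b *: y + c *: z) ->
  (count (fun H : subspace K l => p \in H) E <= 2 * k + 4)%N ->
  ~ is_free E (fun=> 1%N).
Proof.
move=> arrE k4 sB sC uB uC na indep xp yp zp zE linesE inE_ cnt freeE.
have [freeF [ex [ey [ez [[xex xey xez] [yex yey yez] [zex zey zez]]]]]] := dual_points indep.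
set F := \matrix_(i, j) _ in freeF.
pose S := {mpoly K[l]}; pose A2 := {mpoly K[2]}.
have [Phi [PhiC PhiX]] : exists Phi : {rmorphism S -> {poly A2}},
    (forall c, Phi c%:MP = c%:MP%:P) /\ (forall j, Phi 'X_j =
  (p 0 j)%:MP%:P + 'X * (plane_form (ez 0 j) (ex 0 j) (ey 0 j))%:P).
  exists (mmap (polyC \o @mpolyC 2 K : {rmorphism K -> {poly A2}}) (fun j =>
    (p 0 j)%:MP%:P + 'X * (plane_form (ez 0 j) (ex 0 j) (ey 0 j))%:P)).
  split=> [c|j]; first by rewrite /= mmapC.
  by rewrite /= mmapX mmap1U.
have [M [c [c0 logM detM]]] := saito_criterion char0 arrE zE freeE.
have B0 : B != [::] by apply/eqP => B0; move: sB k4; rewrite B0 /= => <-.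
have tan j := expand_tangent arrE PhiC PhiX xp yp zp xex xey xez yex yey yez
  zex zey zez B0 zE linesE (logM j).
have [G [f [uG fv fG]]] := complete_row_free freeF.
pose i0 := f (inord 0); pose i1 := f (inord 1); pose i2 := f (inord 2).
have vi0 : val i0 = 0%N by rewrite fv /= inordK.
have vi1 : val i1 = 1%N by rewrite fv /= inordK.
have vi2 : val i2 = 2%N by rewrite fv /= inordK.
have n01 : i0 != i1 by rewrite -val_eqE vi0 vi1.
have n20 : i2 != i0 by rewrite -val_eqE vi0 vi2.
have n21 : i2 != i1 by rewrite -val_eqE vi1 vi2.
pose X : {poly A2} := ('X_ord0)%:P; pose Y : {poly A2} := ('X_ord_max)%:P.
(* Subtracts X times the z-row from the x-row and Y times the z-row from the y-row, the Euler
   correction as a row operation. It is unitriangular because i2 is larger than i0 and i1. *)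
pose U : 'M[{poly A2}]_l := \matrix_(i, j)
  ((i == j)%:R - X *+ ((i == i0) && (j == i2)) - Y *+ ((i == i1) && (j == i2))).
have detU : \det U = 1.
  rewrite -det_tr det_trig => [|]; last first.
    apply/is_trig_mxP => i j ij; rewrite !mxE.
    have -> : (j == i) = false by rewrite -val_eqE gtn_eqF.
    have -> : (j == i0) && (i == i2) = false.
      by apply/negbTE/negP => /andP[/eqP e1 /eqP e2]; move: ij; rewrite e1 e2 vi0 vi2.
    have -> : (j == i1) && (i == i2) = false.
      by apply/negbTE/negP => /andP[/eqP e1 /eqP e2]; move: ij; rewrite e1 e2 vi1 vi2.
    by rewrite !subr0.
  apply: big1 => i _; rewrite !mxE eqxx.
  have -> : (i == i0) && (i == i2) = false.
    by apply/negbTE/negP => /andP[/eqP -> e]; move: n20; rewrite eq_sym e.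
  have -> : (i == i1) && (i == i2) = false.
    by apply/negbTE/negP => /andP[/eqP -> e]; move: n21; rewrite eq_sym e.
  by rewrite !subr0.
(* After the transposition rows are indexed by linear forms, the first three being x, y, z, and
   columns by the basis fields. *)
pose GM := map_mx (polyC \o @mpolyC 2 K : {rmorphism K -> {poly A2}}) G *m (map_mx Phi M)^T.
have GME i (w : linform K l) j : row (f i) G = \row_t form_coef w t ->
    GM (f i) j = Phi (form_value (row j M) w).
  move=> fi; rewrite mxE /form_value rmorph_sum; apply: eq_bigr => t _.
  have := congr1 (fun A : 'rV_l => A 0 t) fi; rewrite !mxE => ->.
  by rewrite rmorphM /= PhiC mulrC.
have GM0 j : GM i0 j = Phi (form_value (row j M) x).
  by apply: GME; rewrite fG; apply/rowP => t; rewrite !mxE inordK.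
have GM1 j : GM i1 j = Phi (form_value (row j M) y).
  by apply: GME; rewrite fG; apply/rowP => t; rewrite !mxE inordK.
have GM2 j : GM i2 j = Phi (form_value (row j M) z).
  by apply: GME; rewrite fG; apply/rowP => t; rewrite !mxE inordK.
have UGM i j : (U *m GM) i j = GM i j - GM i2 j * (X *+ (i == i0) + Y *+ (i == i1)).
  rewrite mxE (eq_bigr (fun t => (i == t)%:R * GM t j -
      (t == i2)%:R * (GM t j * (X *+ (i == i0) + Y *+ (i == i1))))); last first.
    move=> t _; rewrite mxE; case: (i == t); case: (i == i0); case: (i == i1);
    by case: (t == i2); rewrite /= ?mulr1n ?mulr0n; ring.
  rewrite sumrB (bigD1 i) //= eqxx mul1r big1 => [|t /negPf ti]; last first.
    by rewrite eq_sym ti mul0r.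
  rewrite addr0 (bigD1 i2) //= eqxx mul1r big1 ?addr0 // => t /negPf ->.
  by rewrite mul0r.
have /fin_all_exists2[ff _ tan'] j : exists2 t : {poly A2} * {poly A2} * {poly A2}, True &
    [/\ (U *m GM) i0 j = 'X * t.1.1, (U *m GM) i1 j = 'X * t.1.2, (U *m GM) i2 j = 'X * t.2 &
     forall d, tangent a1 a2 B C t.1.1`_d t.1.2`_d /\
       (msize t.1.1`_d <= d.+2 /\ msize t.1.2`_d <= d.+2)%N].
  have [f0 [g0 [s0 [e1 e2 e3 e4]]]] := tan j; exists (f0, g0, s0) => //=.
  rewrite !UGM !eqxx (negPf n01) (negPf n20) (negPf n21) [i1 == i0]eq_sym (negPf n01).
  rewrite !mulr0n !mulr1n !addr0 add0r mulr0 subr0 GM0 GM1 GM2 -e1 -e2 -e3.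
  by rewrite ![Phi _ * _]mulrC.
have [|w [w0 wE]] := expand_arrangement PhiC PhiX _ arrE.
  move=> H HE pH; have [a [b [d aE]]] := inE_ H HE pH.
  have aEv t : alpha H t = a * x t + b * y t + d * z t :> K.
    by rewrite aE !add_lfunE !scale_lfunE.
  exists a, b, d; split.
  - by rewrite aEv xex yex zex mulr1 !mulr0 !addr0.
  - by rewrite aEv xey yey zey mulr1 !mulr0 add0r addr0.
  - by rewrite aEv xez yez zez mulr1 !mulr0 !add0r.
  apply: contraNT (alpha_neq0 (arrE H HE)); rewrite !negb_or !negbK => /and3P[/eqP a0 /eqP b0 /eqP d0].
  by rewrite aE a0 b0 d0 !scale0r !addr0.
set e := count _ _ in cnt wE.
have detE : \det (U *m GM) = 'X^e * (((\det G)%:MP%:P * c%:MP%:P) * w).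
  rewrite det_mulmx detU mul1r det_mulmx det_tr !det_map_mx detM rmorphM wE /= PhiC.
  by rewrite mulrA [RHS]mulrCA.
(* The x- and y-rows give t^2 and a further t^(2k+2) from their minors, the z-row one more t: the
   total exceeds the order of Q(E) by at least one. *)
have : dvdr ('X^(2 * k + 4) * 'X) (\det (U *m GM)).
  apply: (det_minors_dvdr n01 n20 n21) => [j j'|j]; last first.
    by have [_ _ -> _] := tan' j; exists (ff j).2.
  have [-> -> _ t1] := tan' j; have [-> -> _ t2] := tan' j'.
  rewrite -mulrA mulrCA -['X * _ * _]mulrA ['X * (_ * ('X * _))]mulrCA.
  have [q qE] : dvdr 'X^(2 * k + 2) ((ff j).1.1 * (ff j').1.2 - (ff j').1.1 * (ff j).1.2).
    (* The coefficient of t^m is a sum of planar determinants of fields of degrees at most i + 1 and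
       m - i + 1. These add up to m + 2, which is at most 2k + 3 for m < 2k + 2. *)
    apply: dvdr_polyXn => m mk; rewrite coefB coefM coefMr -sumrB big1 // => i _.
    have [t1i [s1 s2]] := t1 i; have [t2i [s3 s4]] := t2 (m - i)%N.
    apply: (no_tangent_pair char0 k4 sB sC uB uC na t1i t2i (d2 := i.+1) (d3 := (m - i).+1)) => //.
    by have := ltn_ord i; clear -mk; lia.
  exists q.
  rewrite (_ : (2 * k + 4 = (2 * k + 2).+2)%N) ?exprS; last by clear; lia.
  rewrite -!mulrA -qE; ring.
rewrite detE => -[q] /(congr1 (fun h : {poly A2} => h`_e)).
rewrite -exprSr -[(_ * q)`_e]/(('X^_ * q)`_e) !coefXnM ltnn subnn ltnS cnt => /eqP.
rewrite -mulrA !coefCM !mulf_eq0 (negPf w0) orbF !mpolyC_eq0 (negPf c0) orbF.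
by move: uG; rewrite unitmxE unitfE => /negPf ->.
Qed.

(** * Geometry of extensions *)

Section Factors.
Variables (K : fieldType) (l : nat).
Implicit Types (a b w : linform K l) (A : arrangement K l).

Lemma lkerZ (c : K) a : c != 0 -> lker (c *: a) = lker a.
Proof.
move=> c0; apply/vspaceP => v; rewrite !memv_ker scale_lfunE.
by rewrite -[LHS]/(c * a v == 0) mulf_eq0 (negPf c0).
Qed.

Lemma dvdr_forms a b : dvdr (poly_of_form a) (poly_of_form b) ->
  exists c : K, b = c *: a.
Proof.
move=> ab; apply: proportional_forms; apply/subvP => v.
rewrite !memv_ker => /eqP av; have [q qE] := ab.
by rewrite -meval_form qE mevalM meval_form av mul0r.
Qed.

Lemma factor_hyperplane w H : w != 0 -> is_hyperplane H ->
  dvdr (poly_of_form w) (poly_of_form (alpha H)) -> H = lker w.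
Proof.
move=> w0 hH /dvdr_forms[c cE]; rewrite -(lker_alpha hH) cE lkerZ //.
by apply: contraNneq (alpha_neq0 hH) => c0; rewrite cE c0 scale0r.
Qed.

(** Unique factorization: the only hyperplane whose form is divisible by w is its kernel, so the
    exponent of w in the defining polynomial is the multiplicity of that kernel. *)
Lemma factor_multiplicity A m w e R :
  is_arrangement A -> w != 0 -> (0 < e)%N ->
  defining_poly A m = poly_of_form w ^+ e * R -> ~ dvdr (poly_of_form w) R ->
  lker w \in A /\ m (lker w) = e.
Proof.
move=> arrA w0 e0 dE nR; have pw := form_prime w0.
have div H : H \in A -> dvdr (poly_of_form w) (poly_of_form (alpha H) ^+ m H) ->
    H = lker w.
  by move=> HA /(prime_elt_exp pw); apply: factor_hyperplane => //; apply: arrA.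
have wA : lker w \in A.
  have : dvdr (poly_of_form w) (defining_poly A m).
    by rewrite dE -(prednK e0) exprS -mulrA; apply: dvdrMl; apply: dvdr_refl.
  by case/(prime_elt_prod pw) => H HA /(div H HA) <-.
split=> //; have [c wc] : exists c, alpha (lker w) = c *: w.
  by apply: proportional_forms; rewrite lker_alpha ?arrA.
have c0 : c != 0.
  by apply: contraNneq (alpha_neq0 (arrA _ wA)) => c0; rewrite wc c0 scale0r.
have nC d : ~ dvdr (poly_of_form w) (c%:MP ^+ d).
  move/(prime_elt_exp pw) => -[q qE]; apply: pw.1; exists (q * (c^-1)%:MP).
  by rewrite mulrA -qE -mpolyCM mulfV.
apply: (prime_exp_eq (p := poly_of_form w)
  (f := c%:MP ^+ m (lker w) * \prod_(H <- rem (lker w) A) poly_of_form (alpha H) ^+ m H)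
  (g := R)) => //; first exact: poly_of_form_neq0.
  case/pw.2 => [/nC //|/(prime_elt_prod pw)[H]].
  by rewrite mem_rem_uniq ?fset_uniq // inE => /andP[neq HA] /(div H HA) /eqP; apply/negP.
rewrite -dE /defining_poly [in RHS](big_rem (lker w)) //= mulrA; congr (_ * _).
by rewrite wc poly_of_formZ exprMn mulrC.
Qed.

Lemma poly_of_form_homog a : poly_of_form a \is 1.-homog.
Proof.
by apply: rpred_sum => i _; apply: rpredZ; rewrite dhomogX; apply/eqP; apply: mdeg1.
Qed.

Lemma defining_poly_homog A m :
  defining_poly A m \is (\sum_(H <- A) m H)%N.-homog.
Proof.
rewrite /defining_poly; elim: (A : seq _) => [|H s IH].
  by rewrite !big_nil dhomog1.
rewrite !big_cons; apply: dhomogM => //.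
by have := dhomogMn (m H) (poly_of_form_homog (alpha H)); rewrite mul1n.
Qed.

Hypothesis char0 : [pchar K] =i pred0.

Lemma poly_nonroot (f : {poly K}) : f != 0 -> exists t, ~~ root f t.
Proof.
move=> f0; pose rs := [seq (i%:R : K) | i <- iota 0 (size f)].
have [/(max_poly_roots f0)|/allPn[t _ tf]] := boolP (all (root f) rs); last by exists t.
rewrite map_inj_uniq ?iota_uniq; last exact: natr_inj_char0.
by rewrite size_map size_iota ltnn => /(_ isT).
Qed.

(** Induction on the forms: p is moved along a direction q of X on which the new form is nonzero.
    Each form excludes at most one parameter t, and the field is infinite. *)
Lemma generic_point (X : subspace K l) (s : seq (linform K l)) :
  (forall a, a \in s -> ~~ (X <= lker a)%VS) ->
  exists2 p, p \in X & forall a, a \in s -> a p != 0.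
Proof.
elim: s => [|a s IH] hs; first by exists 0; rewrite ?mem0v.
have [p pX ps] := IH (fun b bs => hs b (mem_behead (s := a :: s) bs)).
have /subvPn[q qX] := hs a (mem_head a s); rewrite memv_ker => aq.
pose f (b : linform K l) : {poly K} := (b p)%:P + (b q)%:P * 'X.
have fE b t : (f b).[t] = b (p + t *: q).
  by rewrite !hornerE linearD linearZ /= mulrC.
have f0 b : b \in a :: s -> f b != 0.
  rewrite inE => /predU1P[->|bs].
    apply: contraNneq aq => /(congr1 (fun g : {poly K} => g`_1)) /eqP.
    by rewrite coefD coefC coefMX coefC coef0 add0r.
  apply: contraNneq (ps b bs) => /(congr1 (fun g : {poly K} => g`_0)) /eqP.
  by rewrite coefD coefC coefMX coef0 addr0.
have [|t tr] := @poly_nonroot (\prod_(b <- a :: s) f b).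
  by rewrite prodf_seq_neq0; apply/allP => b bs; rewrite f0.
exists (p + t *: q); first by rewrite memvD ?memvZ.
move=> b bs; apply: contraNneq tr => bz; apply/rootP; rewrite horner_prod.
by rewrite (big_rem b) //= fE [b _]bz mul0r.
Qed.

End Factors.

Lemma seq_preimage (T U : eqType) (s : seq U) (g : T -> U) :
  (forall h, h \in s -> exists a, h = g a) -> exists t, s = map g t.
Proof.
elim: s => [|h s IH] hs; first by exists [::].
have [a ->] := hs h (mem_head _ _).
have [t ->] := IH (fun h' sh => hs h' (mem_behead (s := h :: s) sh)).
by exists (a :: t).
Qed.

Section Extension.
Variables (K : fieldType) (n : nat).
Variables (E : arrangement K n.+1) (A : arrangement K n) (m : subspace K n -> nat).
Variables (H : subspace K n.+1) (phi : 'Hom('rV[K]_n, 'rV[K]_n.+1)).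
Hypotheses (arrE : is_arrangement E) (HE : H \in E).
Hypotheses (kphi : lker phi = 0%VS) (iphi : limg phi = H).
Hypothesis zarr : ziegler_arr E H = [fset (phi @: Y)%VS | Y in A]%fset.
Hypothesis zmult : forall Y, Y \in A -> ziegler_mult E (phi @: Y)%VS = m Y.

Lemma phi_sub Y Y' : (phi @: Y <= phi @: Y')%VS = (Y <= Y')%VS.
Proof.
apply/idP/idP => [/subvP h|]; last exact: limgS.
apply/subvP => v vY; have /memv_imgP[w wY' e] := h _ (memv_img phi vY).
have /lker0P inj : lker phi == 0%VS by rewrite kphi.
by rewrite (inj _ _ e).
Qed.

Lemma hyperplane_eq_dim (G G' : subspace K n.+1) : G \in E -> G' \in E ->
  (G <= G')%VS -> G = G'.
Proof.
move=> GE GE' sub; apply/eqP; rewrite eqEdim sub /=.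
by have := arrE GE; have := arrE GE'; rewrite /is_hyperplane !eqSS => /eqP-> /eqP->.
Qed.

Lemma extension_trace G : G \in E -> G != H ->
  exists2 Y, Y \in A & (H :&: G)%VS = (phi @: Y)%VS.
Proof.
move=> GE neq; have : (H :&: G)%VS \in ziegler_arr E H.
  by apply/imfsetP; exists G => //=; rewrite in_fsetD1 neq GE.
by rewrite zarr => /imfsetP[Y /= YA ->]; exists Y.
Qed.

Lemma restriction_is_arrangement : is_arrangement A.
Proof.
move=> Y YA; have : (phi @: Y)%VS \in ziegler_arr E H.
  by rewrite zarr; apply/imfsetP; exists Y.
case/imfsetP => G /=; rewrite in_fsetD1 => /andP[neq GE] YE.
have dY : \dim (phi @: Y) = \dim Y by rewrite limg_dim_eq // kphi capv0.
have dH : \dim H = n by have := arrE HE; rewrite /is_hyperplane eqSS => /eqP.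
have dG : \dim G = n by have := arrE GE; rewrite /is_hyperplane eqSS => /eqP.
have dS : \dim (H + G) = n.+1.
  apply/eqP; rewrite eqn_leq (leq_trans (dimvS (subvf _)) (eq_leq (dimv_rowspace _ _))) /=.
  rewrite ltnNge; apply: contra neq => dS.
  have /eqP HS : H == (H + G)%VS by rewrite eqEdim addvSl dH.
  by apply/eqP; apply: hyperplane_eq_dim; rewrite // HS addvSr.
have := dimv_sum_cap H G; rewrite -YE dY dH dG dS => e.
by rewrite /is_hyperplane; apply/eqP; move: e; clear; lia.
Qed.

(** For Y in A these are the hyperplanes counted by the Ziegler multiplicity, whose predecessor
    accounts for the omitted H. *)
Definition above (Y : subspace K n) : seq (subspace K n.+1) :=
  [seq G : subspace K n.+1 <- E | (G != H) && (phi @: Y <= G)%VS].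

Lemma size_above Y : Y \in A -> size (above Y) = m Y.
Proof.
move=> YA; rewrite -(zmult YA) /ziegler_mult (cardfsD1 H).
have -> : H \in localization E (phi @: Y)%VS.
  by rewrite !inE HE /= -iphi limgS ?subvf.
rewrite add1n /=; apply: perm_size; apply: uniq_perm; rewrite ?fset_uniq ?filter_uniq //.
  exact: fset_uniq.
by move=> G; rewrite mem_filter !inE -andbA; congr (_ && _); rewrite andbC.
Qed.

(** Pulled back by phi, alpha_G vanishes on Y, hence is c w; c is nonzero since G differs from H.
    Then alpha_G - c x vanishes on H and is a multiple of alpha_H. *)
Lemma above_form Y (w : linform K n) (x : linform K n.+1) G :
  w != 0 -> Y = lker w -> (forall t, x (phi t) = w t) -> G \in above Y ->
  exists a : K, G = lker (x - a *: alpha H).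
Proof.
move=> w0 YE xw; rewrite mem_filter => /andP[/andP[neq YG] GE].
have [c cE] : exists c, (alpha G \o phi)%VF = c *: w.
  apply: proportional_forms; rewrite -YE; apply/subvP => t tY.
  rewrite memv_ker lfunE /= hyperplane_vanish ?arrE //.
  by apply: (subvP YG); apply: memv_img.
have cE' t : alpha G (phi t) = c * w t :> K.
  by have := congr1 (fun f : linform K n => f t) cE; rewrite lfunE scale_lfunE.
have c0 : c != 0.
  apply: contraNneq neq => c0; apply/eqP/esym; apply: hyperplane_eq_dim => //.
  apply/subvP => v; rewrite -iphi => /memv_imgP[t _ ->].
  by rewrite -hyperplane_vanish ?arrE // cE' c0 mul0r.
have [d dE] : exists d, alpha G - c *: x = d *: alpha H.
  apply: proportional_forms; rewrite lker_alpha ?arrE //; apply/subvP => v.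
  rewrite -iphi => /memv_imgP[t _ ->].
  rewrite memv_ker add_lfunE opp_lfunE scale_lfunE xw subr_eq0; apply/eqP; exact: cE'.
exists (- (d / c)); rewrite -{1}(lker_alpha (arrE GE)).
have -> : alpha G = c *: (x - (- (d / c)) *: alpha H).
  by rewrite scaleNr opprK scalerDr scalerA mulrC divfK // -dE addrC subrK.
by rewrite lkerZ.
Qed.

(** Produces the constants of the planar lines: each multiplicity m(Y) becomes a list of m(Y)
    distinct translations of one form. *)
Lemma above_shifts (w : linform K n) (x : linform K n.+1) :
  w != 0 -> lker w \in A -> (forall t, x (phi t) = w t) ->
  exists s : seq K, [/\ size s = m (lker w), uniq s &
    forall a, a \in s -> lker (x - a *: alpha H) \in E].
Proof.
move=> w0 wA xw; have [|s sE] := @seq_preimage K (subspace K n.+1) (above (lker w))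
    (fun a => lker (x - a *: alpha H)).
  by move=> G GY; exact: (above_form w0 (erefl _) xw GY).
exists s; split.
- by rewrite -(size_above wA) sE size_map.
- by apply: (map_uniq (f := fun a => lker (x - a *: alpha H))); rewrite -sE filter_uniq ?fset_uniq.
move=> a sa; have : lker (x - a *: alpha H) \in above (lker w).
  by rewrite sE; apply: (map_f (fun a => lker (x - a *: alpha H))).
by rewrite mem_filter => /andP[].
Qed.

(** Each hyperplane through phi(X) other than H cuts H in some phi(Y) with Y in the localization, so
    it is counted in m(Y); the successor is for H itself. *)
Lemma count_above (X : subspace K n) :
  (count (fun G : subspace K n.+1 => phi @: X <= G)%VS E <=
    (\sum_(Y <- localization A X) m Y).+1)%N.
Proof.
have cE : count (fun G : subspace K n.+1 => phi @: X <= G)%VS E =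
    (count (fun G => (G != H) && (phi @: X <= G)%VS) E).+1.
  have /seq.permP pe := perm_to_rem HE; rewrite !pe /= eqxx /= add0n.
  have -> : (phi @: X <= H)%VS by rewrite -iphi limgS ?subvf.
  rewrite add1n; congr _.+1; apply: eq_in_count => G.
  by rewrite mem_rem_uniq ?fset_uniq // inE => /andP[-> _].
rewrite cE ltnS.
have -> : (\sum_(Y <- localization A X) m Y =
    \sum_(Y <- localization A X) count (fun G => (G != H) && (phi @: Y <= G)%VS) E)%N.
  apply: eq_big_seq => Y; rewrite !inE => /andP[YA _].
  by rewrite -size_filter -(size_above YA).
under eq_bigr do rewrite -sum1_count big_mkcond.
rewrite exchange_big /= -sum1_count big_mkcond /=.
rewrite big_seq [X in (_ <= X)%N]big_seq; apply: leq_sum => G GE.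
case: ifP => // /andP[neq XG]; have [Y YA YE] := extension_trace GE neq.
have YL : Y \in localization A X.
  rewrite !inE YA /= -phi_sub -YE subv_cap XG andbT -iphi.
  by rewrite limgS ?subvf.
by rewrite (big_rem Y) //= neq -YE capvSr.
Qed.

End Extension.

(** * Hyperplanes and multiplicities of a localization of type B_2 *)

Section B2.
Variables (K : fieldType) (n : nat) (L : arrangement K n) (m : subspace K n -> nat).
Hypothesis char0 : [pchar K] =i pred0.
Hypothesis arrL : is_arrangement L.
Variables (u v : linform K n) (c : K) (k : nat).
Hypotheses (k0 : (0 < k)%N) (c0 : c != 0).
Hypothesis indep : forall a b : K, a *: u + b *: v = 0 -> a = 0 /\ b = 0.
Hypothesis dE : defining_poly L m =
  c *: (poly_of_form u ^+ 2 * poly_of_form v ^+ k *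
        poly_of_form (u - v) * poly_of_form (u + v) ^+ k).

Lemma pencil_form_ndvd (a b a' b' : K) : a * b' - a' * b != 0 ->
  ~ dvdr (poly_of_form (a *: u + b *: v)) (poly_of_form (a' *: u + b' *: v)).
Proof.
move=> det0 /dvdr_forms[d dE'].
have [ea eb] : a' - d * a = 0 /\ b' - d * b = 0.
  apply: indep; rewrite !scalerBl addrACA -opprD -!scalerA -scalerDr.
  by rewrite dE' subrr.
move/eqP: ea; rewrite subr_eq0 => /eqP ea; move/eqP: eb; rewrite subr_eq0 => /eqP eb.
by move/eqP: det0; apply; rewrite ea eb; ring.
Qed.

(** The forms u, v, u - v, u + v are pairwise non-proportional, the last two because 2 is nonzero,
    so the exponents can be read off by unique factorization. *)
Lemma B2_multiplicities :
  [/\ lker u \in L /\ m (lker u) = 2, lker v \in L /\ m (lker v) = k,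
      lker (u - v) \in L /\ m (lker (u - v)) = 1%N &
      lker (u + v) \in L /\ m (lker (u + v)) = k].
Proof.
have two0 : 2 != 0 :> K := natr_neq0_char0 char0 (isT : 0 < 2)%N.
have uE : u = 1 *: u + 0 *: v by rewrite scale1r scale0r addr0.
have vE : v = 0 *: u + 1 *: v by rewrite scale1r scale0r add0r.
have dvE : u - v = 1 *: u + (-1) *: v by rewrite scale1r scaleN1r.
have svE : u + v = 1 *: u + 1 *: v by rewrite !scale1r.
have nz (a b : K) : (a != 0) || (b != 0) -> a *: u + b *: v != 0.
  by move=> h; apply/eqP => /indep[a0 b0]; move: h; rewrite a0 b0 eqxx.
have nC w : w != 0 -> ~ dvdr (poly_of_form w) c%:MP.
  move=> w0 [q qE]; apply: (form_prime w0).1; exists (q * (c^-1)%:MP).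
  by rewrite mulrA -qE -mpolyCM mulfV.
have n1 : (1 : K) != 0 := oner_neq0 _.
have key w e f1 e1 f2 e2 f3 e3 : w != 0 -> (0 < e)%N ->
    ~ dvdr (poly_of_form w) (poly_of_form f1) ->
    ~ dvdr (poly_of_form w) (poly_of_form f2) ->
    ~ dvdr (poly_of_form w) (poly_of_form f3) ->
    defining_poly L m = c%:MP * (poly_of_form w ^+ e * (poly_of_form f1 ^+ e1 *
      poly_of_form f2 ^+ e2 * poly_of_form f3 ^+ e3)) ->
    lker w \in L /\ m (lker w) = e.
  move=> w0 e0 h1 h2 h3 h; have pw := form_prime w0.
  apply: (factor_multiplicity (R := c%:MP * (poly_of_form f1 ^+ e1 *
      poly_of_form f2 ^+ e2 * poly_of_form f3 ^+ e3))) => //; first by rewrite h mulrCA.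
  case/pw.2 => [/nC|/pw.2[/pw.2[]|]]; first exact.
  - by move/(prime_elt_exp pw).
  - by move/(prime_elt_exp pw).
  by move/(prime_elt_exp pw).
have dEc := dE; rewrite -mul_mpolyC in dEc.
set d := u - v in dvE dEc *; set s := u + v in svE dEc *.
have u0 : u != 0 by rewrite uE nz ?n1.
have v0 : v != 0 by rewrite vE nz ?n1 ?orbT.
have nd (a b a' b' : K) f g : f = a *: u + b *: v -> g = a' *: u + b' *: v ->
    a * b' - a' * b != 0 -> ~ dvdr (poly_of_form f) (poly_of_form g).
  by move=> -> ->; apply: pencil_form_ndvd.
split.
- apply: (key u 2 v k d 1%N s k) => //.
  + apply: (nd _ _ _ _ _ _ uE vE).
    by have -> : 1 * 1 - 0 * 0 = 1 :> K; [ring | rewrite ?n1].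
  + apply: (nd _ _ _ _ _ _ uE dvE).
    by have -> : 1 * (-1) - 1 * 0 = - 1 :> K; [ring | rewrite ?oppr_eq0 ?n1].
  + apply: (nd _ _ _ _ _ _ uE svE).
    by have -> : 1 * 1 - 1 * 0 = 1 :> K; [ring | rewrite ?n1].
  by rewrite dEc expr1; congr (_ * _); ring.
- apply: (key v k u 2 d 1%N s k) => //.
  + apply: (nd _ _ _ _ _ _ vE uE).
    by have -> : 0 * 0 - 1 * 1 = - 1 :> K; [ring | rewrite ?oppr_eq0 ?n1].
  + apply: (nd _ _ _ _ _ _ vE dvE).
    by have -> : 0 * (-1) - 1 * 1 = - 1 :> K; [ring | rewrite ?oppr_eq0 ?n1].
  + apply: (nd _ _ _ _ _ _ vE svE).
    by have -> : 0 * 1 - 1 * 1 = - 1 :> K; [ring | rewrite ?oppr_eq0 ?n1].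
  by rewrite dEc expr1; congr (_ * _); ring.
- apply: (key d 1%N u 2 v k s k) => //; first by rewrite dvE nz ?n1.
  + apply: (nd _ _ _ _ _ _ dvE uE).
    by have -> : 1 * 0 - 1 * (-1) = 1 :> K; [ring | rewrite ?n1].
  + apply: (nd _ _ _ _ _ _ dvE vE).
    by have -> : 1 * 1 - 0 * (-1) = 1 :> K; [ring | rewrite ?n1].
  + apply: (nd _ _ _ _ _ _ dvE svE).
    by have -> : 1 * 1 - 1 * (-1) = 2 :> K; [ring | rewrite ?two0].
  by rewrite dEc expr1; congr (_ * _); ring.
apply: (key s k u 2 v k d 1%N) => //; first by rewrite svE nz ?n1.
- apply: (nd _ _ _ _ _ _ svE uE).
    by have -> : 1 * 0 - 1 * 1 = - 1 :> K; [ring | rewrite ?oppr_eq0 ?n1].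
- apply: (nd _ _ _ _ _ _ svE vE).
    by have -> : 1 * 1 - 0 * 1 = 1 :> K; [ring | rewrite ?n1].
- apply: (nd _ _ _ _ _ _ svE dvE).
    by have -> : 1 * (-1) - 1 * 1 = - 2 :> K; [ring | rewrite ?oppr_eq0 ?two0].
by rewrite dEc expr1; congr (_ * _); ring.
Qed.

(** A hyperplane of multiplicity zero leaves no trace in the defining polynomial, hence the
    positivity hypothesis. *)
Lemma B2_hyperplane Y : Y \in L -> (0 < m Y)%N ->
  exists a b : K, a *: u + b *: v != 0 /\ Y = lker (a *: u + b *: v).
Proof.
move=> YL mY; have pY := form_prime (alpha_neq0 (arrL YL)).
have nz (a b : K) : (a != 0) || (b != 0) -> a *: u + b *: v != 0.
  by move=> h; apply/eqP => /indep[a0 b0]; move: h; rewrite a0 b0 eqxx.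
have n1 : (1 : K) != 0 := oner_neq0 _.
have use (a b : K) e : (a != 0) || (b != 0) ->
    dvdr (poly_of_form (alpha Y)) (poly_of_form (a *: u + b *: v) ^+ e) ->
    exists a b : K, a *: u + b *: v != 0 /\ Y = lker (a *: u + b *: v).
  move=> /nz ab /(prime_elt_exp pY)/dvdr_forms[d dE']; exists a, b; split=> //.
  rewrite -(lker_alpha (arrL YL)) dE' lkerZ //.
  by apply: contraNneq ab => d0; rewrite dE' d0 scale0r.
have : dvdr (poly_of_form (alpha Y)) (defining_poly L m).
  apply: (dvdr_prodS (i := Y)) => //; rewrite -(prednK mY) exprS.
  by apply: dvdrMl; apply: dvdr_refl.
rewrite dE -mul_mpolyC => /pY.2[[q qE]|].
  case: pY.1; exists (q * (c^-1)%:MP); by rewrite mulrA -qE -mpolyCM mulfV.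
case/pY.2 => [/pY.2[/pY.2[]|]|] h.
- by apply: (use 1 0 2%N); rewrite ?n1 // scale1r scale0r addr0.
- by apply: (use 0 1 k); rewrite ?n1 ?orbT // scale1r scale0r add0r.
- by apply: (use 1 (-1) 1%N); rewrite ?n1 // scale1r scaleN1r expr1.
by apply: (use 1 1 k); rewrite ?n1 // !scale1r.
Qed.

Lemma B2_total_multiplicity : (\sum_(Y <- L) m Y = 2 * k + 3)%N.
Proof.
have h1 := defining_poly_homog L m.
have h2 : defining_poly L m \is (2 + k + 1 + k)%N.-homog.
  have hE (f : linform K n) e := dhomogMn e (poly_of_form_homog f).
  rewrite dE; apply: dhomogZ; apply: dhomogM; last by have := hE (u + v) k; rewrite mul1n.
  apply: dhomogM; last exact: poly_of_form_homog.
  by apply: dhomogM; [have := hE u 2%N | have := hE v k]; rewrite mul1n.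
have nz : defining_poly L m != 0.
  rewrite /defining_poly prodf_seq_neq0; apply/allP => Y YL /=.
  by rewrite expf_neq0 // poly_of_form_neq0 // alpha_neq0 // arrL.
by rewrite (dhomog_uniq nz h1 h2); ring.
Qed.

End B2.

Lemma no_free_extension_B2 (K : fieldType) (char0 : [pchar K] =i pred0) n
    (A : arrangement K n) (m : subspace K n -> nat) X k (E : arrangement K n.+1) :
  (4 <= k)%N -> is_B2_mk (localization A X) m k -> ~ is_free_extension E A m.
Proof.
move=> k4 [u [v [c [fuv c0 dE]]]] [[arrE [H HE [phi [kphi iphi zarr zmult]]]] freeE].
have arrA := restriction_is_arrangement arrE HE kphi zarr.
set L := localization A X in dE.
have LA Y : Y \in L -> Y \in A by rewrite !inE => /andP[].
have LX Y : Y \in L -> (X <= Y)%VS by rewrite !inE => /andP[].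
have arrL : is_arrangement L by move=> Y /LA /arrA.
have indep (a b : K) : a *: u + b *: v = 0 -> a = 0 /\ b = 0.
  move=> e; have /freeP := fuv => /(_ (fun i => if i == 0 :> nat then a else b)).
  rewrite big_ord_recl big_ord1 /= => /(_ e) h.
  by split; [apply: (h ord0) | apply: (h (lift ord0 ord0))].
have k0 : (0 < k)%N by lia.
have [[uL mu] [vL mv] [dL md] [sL ms]] := B2_multiplicities char0 arrL k0 c0 indep dE.
have tot := B2_total_multiplicity arrL dE.
have nz (a b : K) : (a != 0) || (b != 0) -> a *: u + b *: v != 0.
  by move=> h; apply/eqP => /indep[a0 b0]; move: h; rewrite a0 b0 eqxx.
have n1 : (1 : K) != 0 := oner_neq0 _.
have u0 : u != 0 by have := nz 1 0; rewrite scale1r scale0r addr0 n1; apply.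
have v0 : v != 0 by have := nz 0 1; rewrite scale1r scale0r add0r n1 orbT; apply.
have d0 : u - v != 0 by have := nz 1 (-1); rewrite scale1r scaleN1r n1; apply.
have s0 : u + v != 0 by have := nz 1 1; rewrite !scale1r n1; apply.
pose z := alpha H.
have zE : lker z = H by rewrite lker_alpha // arrE.
have zphi t : z (phi t) = 0.
  by apply/eqP; rewrite -memv_ker zE -iphi memv_img ?memvf.
(* [phi^-1] is a left inverse of phi defined on the whole space, so this extends a form from H to
   the ambient space. *)
pose lift (w : linform K n) : linform K n.+1 := (w \o phi^-1)%VF.
have liftE w t : lift w (phi t) = w t.
  by rewrite lfunE /= lker0_lfunK // kphi.
pose x1 := lift u; pose y := lift v.
have yE t : y (phi t) = v t := liftE v t.
have shifts := above_shifts arrE HE iphi zmult.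
have [dl [sdl _ dlE]] := shifts (u - v) (x1 - y) d0 (LA _ dL)
  (fun t => ltac:(by rewrite !add_lfunE !opp_lfunE !liftE)).
have [e eE] : exists e, dl = [:: e].
  by move: sdl; rewrite md; case: dl {dlE} => [|e [|? ?]] // _; exists e.
(* The multiplicity of u - v is 1, so a single hyperplane x1 - y - e z lies over it. Absorbing e
   into x turns it into x - y, without changing the restriction to H. *)
pose x := x1 - e *: z.
have xE t : x (phi t) = u t.
  by rewrite add_lfunE opp_lfunE scale_lfunE zphi scaler0 subr0 liftE.
have xyE : lker (x - y) \in E.
  by have := dlE e; rewrite eE mem_head /x -/z addrAC; apply.
clearbody x y.
have [as_ [sas uas asE]] := shifts u x u0 (LA _ uL) xE.
have [B [sB uB BE]] := shifts v y v0 (LA _ vL) yE.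
have [C [sC uC CE]] := shifts (u + v) (x + y) s0 (LA _ sL)
  (fun t => ltac:(by rewrite !add_lfunE xE yE)).
rewrite -/z in asE BE CE.
have [a1 [a2 aE]] : exists a1 a2, as_ = [:: a1; a2].
  move: sas; rewrite mu; case: as_ {uas asE} => [|a1 [|a2 [|? ?]]] // _.
  by exists a1, a2.
rewrite {}aE in uas asE.
have na : a1 != a2 by move: uas; rewrite /= inE andbT.
(* The point p of phi(X) avoids every hyperplane that does not contain phi(X), so the hyperplanes
   through p are exactly those of the localization. *)
pose bad := [seq alpha G | G <- [seq G : subspace K n.+1 <- E | ~~ (phi @: X <= G)%VS]].
have [|p pX pbad] := @generic_point _ _ char0 (phi @: X)%VS bad.
  move=> a /mapP[G]; rewrite mem_filter => /andP[XG GE] ->.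
  by rewrite lker_alpha ?arrE.
have pin G : G \in E -> p \in G -> (phi @: X <= G)%VS.
  move=> GE pG; apply: contraLR pG => XG; rewrite -hyperplane_vanish ?arrE //.
  by apply: pbad; apply: map_f; rewrite mem_filter XG.
have [q qX pE] := memv_imgP pX.
have zero w : lker w \in L -> w q = 0.
  by move=> /LX /subvP /(_ q qX); rewrite memv_ker => /eqP.
apply: (not_free_of_localization char0 (x := x) (y := y) (z := z) (p := p)
  (k := k) (a1 := a1) (a2 := a2) (B := B) (C := C)) freeE => //.
- by rewrite sB.
- by rewrite sC.
- move=> a b d e0.
  have [a0 b0] : a = 0 /\ b = 0.
    apply: indep; apply/lfunP => t; have := congr1 (fun f : linform K n.+1 => f (phi t)) e0.
    by rewrite !(add_lfunE, scale_lfunE) xE yE zphi scaler0 addr0 !lfunE.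
  split=> //; move/eqP: e0; rewrite a0 b0 !scale0r !add0r scaler_eq0.
  by rewrite (negPf (alpha_neq0 (arrE _ HE))) orbF => /eqP.
- by rewrite pE xE zero.
- by rewrite pE yE zero.
- by rewrite pE zphi.
- by rewrite zE.
- split=> //; split; apply: asE; first exact: mem_head.
  by rewrite !inE eqxx orbT.
- move=> G GE pG; have [->|neq] := eqVneq G H.
    by exists 0, 0, 1; rewrite !scale0r !add0r scale1r.
  have XG := pin G GE pG.
  have [Y YA YE] := extension_trace zarr GE neq.
  have GY : G \in above E H phi Y by rewrite mem_filter neq GE -YE capvSr.
  have YL : Y \in L.
    rewrite !inE YA /= -(phi_sub kphi) -YE subv_cap XG andbT -iphi.
    by rewrite limgS ?subvf.
  have mY : (0 < m Y)%N by rewrite -(size_above HE iphi zmult YA); case: above GY.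
  have [a [b [ab0 YE']]] := B2_hyperplane arrL c0 indep dE YL mY.
  have wE t : (a *: x + b *: y) (phi t) = (a *: u + b *: v) t.
    by rewrite !(add_lfunE, scale_lfunE) xE yE.
  have [d GE'] := above_form arrE HE iphi ab0 YE' wE GY.
  have [g gE] : exists g, alpha G = g *: (a *: x + b *: y - d *: z).
    by apply: proportional_forms; rewrite lker_alpha ?arrE // -GE'.
  by exists (g * a), (g * b), (- (g * d)); rewrite gE scalerBr scalerDr !scalerA scaleNr.
have := count_above HE kphi iphi zarr zmult X; rewrite -/L tot.
rewrite (_ : (2 * k + 3).+1 = 2 * k + 4)%N; last by clear; lia.
apply: leq_trans; rewrite -!size_filter; apply: uniq_leq_size.
  by rewrite filter_uniq ?fset_uniq.
by move=> G; rewrite !mem_filter => /andP[pG GE]; rewrite pin.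
Qed.

Theorem theorem1p2 (K : fieldType) (char0 : [pchar K] =i pred0)
    (n : nat) (m : subspace K n -> nat) :
  (exists (X : subspace K n) (k : nat),
     [/\ in_lattice (coxeterB K n) X, rank X = 2%N, (4 <= k)%N &
         is_B2_mk (localization (coxeterB K n) X) m k]) ->
  ~ exists E : arrangement K n.+1, is_free_extension E (coxeterB K n) m.
Proof.
case=> X [k [_ _ k4 B2]] [E].
exact: no_free_extension_B2 k4 B2.
Qed.
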